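(* Let $\mathcal{L}$ be a quasi-Banach lattice. (i) If $\mathcal{L}$ is $L$-convex, then for every $0<r<\infty$ there is a constant $C$ such that $L_2(\varphi)\le C A_r(\varphi)$ for every finite family $\varphi$ in $\mathcal{L}$. (ii) If $\mathcal{L}$ is $L$-concave, then for every $0<r<\infty$ there is a constant $C$ such that $L_2(\varphi)\le C A_r(\varphi)$ and $A_r(\varphi)\le C L_2(\varphi)$ for every finite family $\varphi$ in $\mathcal{L}$.
   Context: A quasi-Banach lattice is a (real) vector lattice with a complete quasi-norm such that $\|x\|\le\|y\|$ whenever $|x|\le|y|$. Expressions $(\sum_{j}|f_j|^r)^{1/r}$ are defined by the lattice (Krivine) functional calculus, which is available in quasi-Banach lattices. For a finite family $\varphi=(f_j)_{j\in J}$ in $\mathcal{L}$ and $0<r<\infty$, $$A_r(\varphi)=\Big(2^{-|J|}\sum_{(\varepsilon_j)\in\{-1,1\}^J}\Big\|\sum_{j\in J}\varepsilon_jf_j\Big\|^r\Big)^{1/r},\qquad L_2(\varphi)=\Big\|\Big(\sum_{j\in J}|f_j|^2\Big)^{1/2}\Big\|.$$ $\mathcal{L}$ is $L$-convex if there is $0<\varepsilon<1$ such that $\varepsilon\|f\|\le\max_{j\in J}\|f_j\|$ whenever $f\in\mathcal{L}$ and the finite family $(f_j)_{j\in J}$ satisfy $0\le f_j\le f$ for all $j\in J$ and $\sum_{j\in J}f_j\ge(1-\varepsilon)|J|f$. (Equivalently, by a theorem of Kalton, there are $0<s<\infty$ and $C$ with $\|(\sum_j|f_j|^s)^{1/s}\|\le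 C(\sum_j\|f_j\|^s)^{1/s}$ for all finite families.) $\mathcal{L}$ is $L$-concave if there are $0<s<\infty$ and a constant $C$ such that $(\sum_{j}\|f_j\|^s)^{1/s}\le C\|(\sum_{j}|f_j|^s)^{1/s}\|$ for every finite family $(f_j)_{j\in J}$ in $\mathcal{L}$. *)

(* Defs.v *)
From HB Require Import structures.
From mathcomp Require Import all_boot all_order all_algebra.
From mathcomp Require Import all_classical all_reals all_analysis.

Set Implicit Arguments.
Unset Strict Implicit.
Unset Printing Implicit Defensive.

Import Order.TTheory GRing.Theory Num.Theory.
Import numFieldNormedType.Exports.

Local Open Scope classical_set_scope.
Local Open Scope ring_scope.

(* The library's Order.Lattice cannot be joined with GRing.Lmodule in an HB
   structure (the join with Num.RealDomain is missing), so the binary suprema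
   and infima are part of the mixin. *)
HB.mixin Record isVectorLattice (R : realType) V
    of GRing.Lmodule R V & Order.isPOrder ring_display V := {
  vlat_leD2r : forall z x y : V, x <= y -> x + z <= y + z ;
  vlat_leZ2l : forall (a : R) (x y : V), 0 <= a -> x <= y -> a *: x <= a *: y ;
  vjoin : V -> V -> V ;
  vmeet : V -> V -> V ;
  vjoin_le : forall x y z : V, (vjoin x y <= z) = (x <= z) && (y <= z) ;
  le_vmeet : forall x y z : V, (z <= vmeet x y) = (z <= x) && (z <= y)
}.

#[short(type="vectorLatticeType")]
HB.structure Definition VectorLattice (R : realType) :=
  { V of GRing.Lmodule R V & Order.isPOrder ring_display V
       & isVectorLattice R V }.

Definition vabs (R : realType) (V : vectorLatticeType R) (x : V) : V :=
  vjoin x (- x).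

(* A quasi-norm induces a metrizable vector topology, so completeness is
   expressed with Cauchy sequences. *)
HB.mixin Record isQuasiBanach (R : realType) V of VectorLattice R V := {
  qnorm : V -> R ;
  qnorm_ge0 : forall x : V, 0 <= qnorm x ;
  qnorm0_eq0 : forall x : V, qnorm x = 0 -> x = 0 ;
  qnormZ : forall (a : R) (x : V), qnorm (a *: x) = `|a| * qnorm x ;
  qnorm_quasi_triangle :
    exists K : R, forall x y : V, qnorm (x + y) <= K * (qnorm x + qnorm y) ;
  qnorm_le_vabs : forall x y : V, vabs x <= vabs y -> qnorm x <= qnorm y ;
  qnorm_complete : forall u : nat -> V,
    (forall e : R, 0 < e -> exists N : nat, forall m n : nat,
        (N <= m)%N -> (N <= n)%N -> qnorm (u m - u n) < e) ->
    exists l : V, qnorm (u n - l) @[n --> \oo] --> (0 : R)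
}.

#[short(type="quasiBanachLatticeType")]
HB.structure Definition QuasiBanachLattice (R : realType) :=
  { V of VectorLattice R V & isQuasiBanach R V }.

(* The domain of Krivine's calculus in variables indexed by J: continuous,
   positively homogeneous functions on R^J. *)
Definition pos_homogeneous_fun (R : realType) (J : finType)
    (h : (J -> R) -> R) : Prop :=
  continuous (h : {ptws J -> R} -> R) /\
  (forall (a : R) (t : J -> R), 0 <= a -> h (fun j => a * t j) = a * h t).

(* A functional calculus for the family f is a linear lattice homomorphism Phi
   from the space above to L mapping the j-th coordinate function to f j; the
   values of Phi outside that space are irrelevant. *)
Definition is_functional_calculus (R : realType) (L : vectorLatticeType R)
    (J : finType) (f : J -> L) (Phi : ((J -> R) -> R) -> L) : Prop :=
  [/\ forall j : J, Phi (fun t => t j) = f j,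
      forall (a : R) (g h : (J -> R) -> R),
        pos_homogeneous_fun g -> pos_homogeneous_fun h ->
        Phi (fun t => a * g t + h t) = a *: Phi g + Phi h,
      forall g h : (J -> R) -> R,
        pos_homogeneous_fun g -> pos_homogeneous_fun h ->
        Phi (fun t => Num.max (g t) (h t)) = vjoin (Phi g) (Phi h)
    & forall g h : (J -> R) -> R,
        pos_homogeneous_fun g -> pos_homogeneous_fun h ->
        Phi (fun t => Num.min (g t) (h t)) = vmeet (Phi g) (Phi h)].

(* The element h((f_j)_j) of L. In a quasi-Banach lattice the functional
   calculus of a finite family exists and is unique (Krivine), so the default
   value 0 is never used when h is continuous and positively homogeneous. *)
Definition krivine (R : realType) (L : vectorLatticeType R) (J : finType)
    (f : J -> L) (h : (J -> R) -> R) : L :=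
  xget 0 [set y | exists2 Phi, is_functional_calculus f Phi & Phi h = y].

Definition lsum (R : realType) (L : vectorLatticeType R) (r : R) (J : finType)
    (f : J -> L) : L :=
  krivine f (fun t => (\sum_(j : J) `|t j| `^ r) `^ r^-1).

(* The sign family (eps_j) is encoded by booleans, eps_j = (-1) ^+ e j. *)
Definition A_avg (R : realType) (L : quasiBanachLatticeType R) (r : R)
    (J : finType) (f : J -> L) : R :=
  ((2 ^+ #|J|)^-1 *
     \sum_(e : {ffun J -> bool}) qnorm (\sum_(j : J) (-1) ^+ e j *: f j) `^ r)
  `^ r^-1.

Definition L2_norm (R : realType) (L : quasiBanachLatticeType R)
    (J : finType) (f : J -> L) : R :=
  qnorm (lsum 2 f).

(* The family must be nonempty: for an empty one the condition would read
   eps * qnorm f <= max of the empty set for every f >= 0. *)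
Definition L_convex (R : realType) (L : quasiBanachLatticeType R) : Prop :=
  exists eps : R, [/\ 0 < eps, eps < 1 &
    forall (J : finType) (F : J -> L) (f : L),
      (0 < #|J|)%N ->
      (forall j : J, 0 <= F j /\ F j <= f) ->
      ((1 - eps) * #|J|%:R) *: f <= \sum_(j : J) F j ->
      eps * qnorm f <= \big[Num.max/0]_(j : J) qnorm (F j)].

Definition L_concave (R : realType) (L : quasiBanachLatticeType R) : Prop :=
  exists s C : R, 0 < s /\
    forall (J : finType) (f : J -> L),
      (\sum_(j : J) qnorm (f j) `^ s) `^ s^-1 <= C * qnorm (lsum s f).

(* Main.v *)
(* (i) Work with one functional calculus of the family (f_j), so that pointwise
   inequalities between continuous homogeneous functions become inequalities in
   L. By Paley-Zygmund a random sum X = \sum_j eps_j t_j is at least half the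
   square function with probability bounded below, hence among N independent
   copies one of them is, with probability close to 1. Discard the signs for
   which \sum_j eps_j f_j has large norm (few, by Markov). L-convexity, applied
   over all N-tuples of sign vectors to the truncations of 2 \sum_i |X_i| at the
   square function, yields the lower estimate for every exponent r, with no
   appeal to Kalton's theorem.

   (ii) L-concavity with exponent s passes to every q >= s by Hoelder. For
   q >= 1 it implies L-convexity, hence the lower estimate by (i). For an even
   q = 2m it gives the upper estimate: apply it to the family of all signed sums
   and use the scalar Khintchine inequality.

   The calculus of the family of signed sums, or of a rescaled family, is
   obtained from that of (f_j) by composition; this needs the uniqueness of the
   calculus, which follows from the uniform approximation on the l1-sphere by
   lattice-linear functions. Its existence is never needed. *)

Require Import Defs.
From mathcomp Require Import all_boot all_order all_algebra.
From mathcomp Require Import all_classical all_reals all_analysis.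
From mathcomp Require Import ring lra.

Set Implicit Arguments.
Unset Strict Implicit.
Unset Printing Implicit Defensive.

Import Order.TTheory GRing.Theory Num.Theory.
Import numFieldNormedType.Exports.

Local Open Scope ring_scope.

(** * Rademacher sums *)

Section SignAverages.
Variables (R : realType) (J : finType).
Implicit Types (t : J -> R) (e : {ffun J -> bool}).

Definition signed_sum e t : R := \sum_(j : J) (-1) ^+ e j * t j.

Lemma card_signs : #|{: {ffun J -> bool}}|%:R = 2 ^+ #|J| :> R.
Proof. by rewrite card_ffun card_bool natrX. Qed.

Lemma sum_prod_signs (G : J -> bool -> R) :
  \sum_(e : {ffun J -> bool}) \prod_(j : J) G j (e j) =
  \prod_(j : J) (G j true + G j false).
Proof.
rewrite -(bigA_distr_bigA G); apply: eq_bigr => j _.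
by rewrite big_bool.
Qed.

(** Orthogonality of independent signs: for distinct indices, the two values of the sign at [i]
    cancel. *)
Lemma sum_signs_mul (i j : J) :
  \sum_(e : {ffun J -> bool}) ((-1) ^+ e i * (-1) ^+ e j : R) =
  if i == j then 2 ^+ #|J| else 0.
Proof.
case: eqVneq => [->|nij].
  rewrite -card_signs -sum1_card natr_sum; apply: eq_bigr => e _.
  by rewrite -signr_addb addbb.
pose G (k : J) (b : bool) : R := if (k == i) || (k == j) then (-1) ^+ b else 1.
transitivity (\sum_(e : {ffun J -> bool}) \prod_(k : J) G k (e k)).
  apply: eq_bigr => e _.
  rewrite (bigD1 i) //= (bigD1 j) 1?eq_sym //= big1 => [|k /andP[/negbTE ki /negbTE kj]].
    by rewrite /G !eqxx orbT mulr1.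
  by rewrite /G ki kj.
by rewrite sum_prod_signs (bigD1 i) //= /G eqxx /= expr0 expr1 addNr mul0r.
Qed.

Lemma sum_signed_sum_sqr t :
  \sum_(e : {ffun J -> bool}) signed_sum e t ^+ 2 =
  2 ^+ #|J| * \sum_(j : J) t j ^+ 2.
Proof.
transitivity (\sum_(i : J) \sum_(j : J) t i * t j *
   \sum_(e : {ffun J -> bool}) ((-1) ^+ e i * (-1) ^+ e j : R)).
  under [RHS]eq_bigr => i _ do
    (under eq_bigr => j _ do rewrite big_distrr /=; rewrite exchange_big /=).
  rewrite exchange_big /=; apply: eq_bigr => e _.
  rewrite expr2 big_distrl /=; apply: eq_bigr => i _.
  rewrite big_distrr /=; apply: eq_bigr => j _.
  by ring.
rewrite big_distrr /=; apply: eq_bigr => i _.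
under eq_bigr do rewrite sum_signs_mul.
rewrite (bigD1 i) //= big1 => [|j /negbTE ji]; last by rewrite eq_sym ji mulr0.
by rewrite eqxx addr0 mulrC -expr2.
Qed.

End SignAverages.

(** * Scalar Khintchine and Paley-Zygmund inequalities *)

Section ScalarKhintchine.
Variable R : realType.

(** A sub-Gaussian bound with a crude constant. For [x ^+ 2 <= 1/2], [expR y <= (1 - y)^-1] at [x]
    and [- x] bounds the sum by [2 / (1 - x ^+ 2)]; otherwise [|x| <= 2 * x ^+ 2] bounds each
    exponential separately. *)
Lemma expRD_opp_le (x : R) : expR x + expR (- x) <= 2 * expR (2 * x ^+ 2).
Proof.
have [x2|x2] := leP (x ^+ 2) 2^-1.
  have h1 : (1 + x) * (1 - x) >= 1 / 2 by lra.
  have px : 0 < 1 + x by nra.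
  have mx : 0 < 1 - x by nra.
  have inv (y : R) : 0 < 1 - y -> expR y <= (1 - y)^-1.
    move=> hy; rewrite -[expR y]invrK -expRN lef_pV2 ?posrE ?expR_gt0 //.
    exact: expR_ge1Dx.
  have e1 := inv _ mx.
  have e2 : expR (- x) <= (1 + x)^-1 by have := inv (- x); rewrite opprK; apply.
  apply: (le_trans (lerD e1 e2)).
  have -> : (1 - x)^-1 + (1 + x)^-1 = 2 * (1 - x ^+ 2)^-1.
    by field; apply/and3P; split; apply/lt0r_neq0; nra.
  rewrite ler_pM2l //; apply: (@le_trans _ _ (1 + 2 * x ^+ 2)); last exact: expR_ge1Dx.
  rewrite -[leLHS]mul1r ler_pdivrMr; nra.
have ab : `|x| <= 2 * x ^+ 2.
  rewrite -real_normK ?num_real // in x2 *.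
  have := normr_ge0 x; nra.
have le1 : expR x <= expR (2 * x ^+ 2).
  by rewrite ler_expR (le_trans _ ab)// ler_norm.
have le2 : expR (- x) <= expR (2 * x ^+ 2).
  by rewrite ler_expR (le_trans _ ab)// -normrN ler_norm.
lra.
Qed.

(** With [k = 2 * m > 0] and [y >= 0], raise [y / k <= expR (y / k)] to the power [k]. By evenness
    this applies to whichever of [x] and [- x] is nonnegative. *)
Lemma even_power_le_expR (m : nat) (x : R) :
  x ^+ (2 * m) <= (2 * m)%:R ^+ (2 * m) * (expR x + expR (- x)).
Proof.
case: m => [|m].
  rewrite muln0 !expr0 mul1r.
  by have := expR_ge1Dx x; have := expR_ge1Dx (- x); lra.
set k := (2 * m.+1)%N.
have k0 : 0 < k%:R :> R by rewrite ltr0n.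
have key (y : R) : 0 <= y -> y ^+ k <= k%:R ^+ k * expR y.
  move=> y0.
  have -> : expR y = expR (y / k%:R) ^+ k.
    by rewrite -expRM_natl mulrC divfK // gt_eqF.
  rewrite -exprMn ler_pXn2r // ?nnegrE ?mulr_ge0 ?expR_ge0 //.
  rewrite mulrC -ler_pdivrMr //.
  by apply: le_trans (expR_ge1Dx _); rewrite lerDr.
have ev (y : R) : (- y) ^+ k = y ^+ k by rewrite exprNn /k exprM sqrrN expr1n expr1n mul1r.
rewrite mulrDr; have [x0|x0] := leP 0 x.
  by apply: (le_trans (key _ x0)); rewrite lerDl mulr_ge0 ?exprn_ge0 ?expR_ge0 // ltW.
have nx0 : 0 <= - x by lra.
by rewrite -ev; apply: (le_trans (key _ nx0)); rewrite lerDr mulr_ge0 ?exprn_ge0 ?expR_ge0 // ltW.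
Qed.

(** By independence the exponential moment factors over the coordinates, and [expRD_opp_le] bounds
    each factor. *)
Lemma sum_expR_signed_sum_le (J : finType) (t : J -> R) :
  \sum_(e : {ffun J -> bool}) expR (signed_sum e t) <=
  2 ^+ #|J| * expR (2 * \sum_(j : J) t j ^+ 2).
Proof.
pose G j (b : bool) : R := expR ((-1) ^+ b * t j).
have -> : \sum_(e : {ffun J -> bool}) expR (signed_sum e t) =
          \sum_(e : {ffun J -> bool}) \prod_(j : J) G j (e j).
  by apply: eq_bigr => e _; rewrite /signed_sum expR_sum.
rewrite sum_prod_signs mulr_sumr expR_sum -prodr_const -big_split /=.
apply: ler_prod => j _; rewrite addr_ge0 ?expR_ge0 //= /G expr0 expr1 mulN1r mul1r addrC.
exact: expRD_opp_le.
Qed.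

Lemma signed_sum_scale (J : finType) (e : {ffun J -> bool}) (a : R) (t : J -> R) :
  signed_sum e (fun j => a * t j) = a * signed_sum e t.
Proof. by rewrite /signed_sum mulr_sumr; apply: eq_bigr => j _; rewrite mulrCA. Qed.

(** The 2 counts the two exponentials of [even_power_le_expR]; [expR 2] is the exponential moment
    bound when the squares sum to 1. *)
Definition khintchine_const (m : nat) : R :=
  2 * (2 * m)%:R ^+ (2 * m) * expR 2.

(** Homogeneity reduces to squares summing to 1; there the even power is dominated by the
    exponentials of the signed sum and of its opposite. *)
Lemma sum_signed_sum_even_power_le (m : nat) (J : finType) (t : J -> R) :
  (0 < m)%N ->
  \sum_(e : {ffun J -> bool}) signed_sum e t ^+ (2 * m) <=
  khintchine_const m * 2 ^+ #|J| * (\sum_(j : J) t j ^+ 2) ^+ m.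
Proof.
move=> m0; set S := \sum_(j : J) t j ^+ 2.
have S0 : 0 <= S by apply: sumr_ge0 => j _; rewrite sqr_ge0.
have K0 : 0 <= khintchine_const m.
  by rewrite /khintchine_const !mulr_ge0 ?exprn_ge0 ?expR_ge0.
have [Sz|Sn] := eqVneq S 0.
  have t0 j : t j = 0.
    apply/eqP; rewrite -sqrf_eq0; apply/eqP/le_anti; rewrite sqr_ge0 andbT -Sz.
    by rewrite /S (bigD1 j) //= lerDl sumr_ge0 // => i _; rewrite sqr_ge0.
  rewrite big1 ?mulr_ge0 ?exprn_ge0 // => e _.
  rewrite /signed_sum big1 ?expr0n ?muln_eq0 //= => [|j _]; last by rewrite t0 mulr0.
  by case: (m) m0.
have Sp : 0 < S by rewrite lt_neqAle eq_sym Sn.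
have sp : 0 < Num.sqrt S by rewrite sqrtr_gt0.
pose u j := (Num.sqrt S)^-1 * t j.
have u1 : \sum_(j : J) u j ^+ 2 = 1.
  under eq_bigr do rewrite exprMn exprVn sqr_sqrtr //.
  by rewrite -mulr_sumr mulVf.
have main : \sum_(e : {ffun J -> bool}) signed_sum e u ^+ (2 * m) <=
    khintchine_const m * 2 ^+ #|J|.
  apply: (@le_trans _ _ (\sum_(e : {ffun J -> bool}) (2 * m)%:R ^+ (2 * m) *
     (expR (signed_sum e u) + expR (signed_sum e (fun j => (-1) * u j))))).
    by apply: ler_sum => e _; rewrite (signed_sum_scale e (-1) u) mulN1r even_power_le_expR.
  rewrite -mulr_sumr big_split /=.
  have e1 := sum_expR_signed_sum_le u.
  have e2 := sum_expR_signed_sum_le (fun j => -1 * u j).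
  have u2 : \sum_(j : J) (-1 * u j) ^+ 2 = 1.
    by rewrite -[RHS]u1; apply: eq_bigr => j _; rewrite mulN1r sqrrN.
  rewrite u1 mulr1 in e1; rewrite u2 mulr1 in e2.
  rewrite /khintchine_const (_ : 2 * _ * _ * _ = (2 * m)%:R ^+ (2 * m) *
    (2 ^+ #|J| * expR 2 + 2 ^+ #|J| * expR 2)); last by ring.
  by rewrite ler_wpM2l ?exprn_ge0 // lerD.
have -> : \sum_(e : {ffun J -> bool}) signed_sum e t ^+ (2 * m) =
    S ^+ m * \sum_(e : {ffun J -> bool}) signed_sum e u ^+ (2 * m).
  rewrite mulr_sumr; apply: eq_bigr => e _.
  rewrite /u signed_sum_scale exprMn [in RHS]exprM exprVn sqr_sqrtr // exprVn.
  by rewrite mulVKf // expf_neq0.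
by rewrite [leRHS]mulrC ler_wpM2l ?exprn_ge0.
Qed.

(* Paley-Zygmund from the fourth moment: on the good signs
   [X^2 <= X^4 / (2 C) + C / 2]. *)
Lemma card_small_signed_sum : exists2 d : R, 0 < d <= 1 &
  forall (J : finType) (t : J -> R),
    #|[pred e : {ffun J -> bool} |
         4 * signed_sum e t ^+ 2 < \sum_(j : J) t j ^+ 2]|%:R
    <= (1 - d) * 2 ^+ #|J|.
Proof.
pose C := khintchine_const 2.
have C1 : 1 <= C.
  rewrite /C /khintchine_const; have := expR_ge1Dx (2 : R); rewrite (_ : (2 * 2)%N = 4%N) // => h.
  have : 1 <= 4 ^+ 4 :> R by rewrite exprn_ege1 // ler1n.
  by nra.
(* If [b] is the proportion of small sums, the estimate below reads
   [1/2 <= b / 4 + (1 - b) * C / 2]. Since [b <= 1], this gives [1 - b >= 1 / (2 * C)]. *)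
exists (2 * C)^-1.
  by apply/andP; split; rewrite ?invr_gt0 ?invf_le1; lra.
move=> J t; set S := \sum_(j : J) t j ^+ 2.
have S0 : 0 <= S by apply: sumr_ge0 => j _; rewrite sqr_ge0.
set B := [pred e : {ffun J -> bool} | _]; set P : R := 2 ^+ #|J|.
have P0 : 0 < P by rewrite exprn_gt0.
have [Sz|Sn] := eqVneq S 0.
  rewrite eq_card0 => [|e]; last first.
    by rewrite !inE Sz; apply/negbTE; rewrite -leNgt mulr_ge0 ?sqr_ge0.
  by rewrite mulr_ge0 ?(ltW P0) // subr_ge0 invf_le1; lra.
have Sp : 0 < S by rewrite lt_neqAle eq_sym Sn.
have m2 := sum_signed_sum_sqr t.
have m4 := @sum_signed_sum_even_power_le 2 J t isT.
rewrite -/S -/P -/C in m2 m4.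
have split : P * S <= #|B|%:R * (S / 4) +
   (C * P * S ^+ 2 / (2 * C * S) + (P - #|B|%:R) * (C * S / 2)).
  rewrite -m2 (bigID B) /=; apply: lerD.
    rewrite -sum1_card natr_sum mulr_suml; apply: ler_sum => e /= h.
    by rewrite mul1r; lra.
  apply: (@le_trans _ _ (\sum_(e | ~~ B e)
     (signed_sum e t ^+ (2 * 2) / (2 * C * S) + C * S / 2))).
    apply: ler_sum => e _; rewrite exprM; set x := signed_sum e t ^+ 2.
    rewrite -subr_ge0 (_ : _ - x = (x - C * S) ^+ 2 / (2 * C * S)).
      by rewrite divr_ge0 ?sqr_ge0 // !mulr_ge0 //; lra.
    by field; rewrite Sn /=; apply/lt0r_neq0; lra.
  rewrite big_split /= -mulr_suml; apply: lerD.
    rewrite ler_wpM2r ?invr_ge0 ?mulr_ge0//; try lra.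
    apply: le_trans m4; rewrite [leRHS](bigID B) /= lerDr.
    by apply: sumr_ge0 => e _; rewrite exprM sqr_ge0.
  have -> : P - #|B|%:R = #|[predC B]|%:R.
    by rewrite /P -card_signs -(cardC B) natrD addrAC subrr add0r.
  by rewrite -sum1_card natr_sum mulr_suml; apply: ler_sum => e _; rewrite mul1r.
have e1 : C * P * S ^+ 2 / (2 * C * S) = P * S / 2.
  by field; rewrite Sn /=; apply/lt0r_neq0; lra.
rewrite e1 in split.
have {}split : P <= #|B|%:R / 4 + (P / 2 + (P - #|B|%:R) * (C / 2)).
  rewrite -(ler_pM2r Sp); apply: le_trans split _.
  by rewrite le_eqVlt; apply/orP; left; apply/eqP; field.
have BP : #|B|%:R <= P by rewrite /P -card_signs ler_nat max_card.
have hh : (P / (2 * C)) * C = P / 2 by field; apply/lt0r_neq0; lra.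
rewrite mulrBl mul1r [_^-1 * _]mulrC.
rewrite -(ler_pM2r (_ : 0 < C)); last lra.
rewrite mulrBl hh; lra.
Qed.

End ScalarKhintchine.

(** * Vector lattices and positively homogeneous functions *)

Section VectorLatticeTheory.
Variables (R : realType) (V : vectorLatticeType R).
Implicit Types x y z : V.

Lemma vlat_leD x1 x2 y1 y2 : x1 <= y1 -> x2 <= y2 -> x1 + x2 <= y1 + y2.
Proof.
move=> h1 h2; apply: le_trans (vlat_leD2r x2 _ _ h1) _.
by rewrite ![y1 + _]addrC; exact: vlat_leD2r.
Qed.

Lemma vlat_subr_ge0 x y : (0 <= y - x) = (x <= y).
Proof.
apply/idP/idP => h; first by have := vlat_leD2r x _ _ h; rewrite add0r subrK.
by have := vlat_leD2r (- x) _ _ h; rewrite subrr.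
Qed.

Lemma vlat_leN x y : x <= y -> - y <= - x.
Proof. by rewrite -(vlat_subr_ge0 x y) -(vlat_subr_ge0 (- y)) opprK addrC. Qed.

Lemma le_vabs x : x <= vabs x.
Proof. by have := lexx (vabs x); rewrite {1}/vabs vjoin_le => /andP[]. Qed.

Lemma leN_vabs x : - x <= vabs x.
Proof. by have := lexx (vabs x); rewrite {1}/vabs vjoin_le => /andP[]. Qed.

Lemma vabs_ge0 x : 0 <= vabs x.
Proof.
have h := vlat_leD (le_vabs x) (leN_vabs x); rewrite subrr in h.
have half : 0 <= 2^-1 :> R by rewrite invr_ge0.
have := vlat_leZ2l 2^-1 _ _ half h; rewrite scaler0.
by rewrite -[vabs x]scale1r -scalerDl scalerA (_ : _ * _ = 1) ?scale1r //; field.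
Qed.

Lemma ge0_vabs x : 0 <= x -> vabs x = x.
Proof.
move=> x0; apply/le_anti; rewrite le_vabs andbT /vabs vjoin_le lexx /=.
by apply: (le_trans _ x0); have := vlat_leN x0; rewrite oppr0.
Qed.

Lemma vabs_le x y : x <= y -> - x <= y -> vabs x <= y.
Proof. by move=> h1 h2; rewrite /vabs vjoin_le h1 h2. Qed.

End VectorLatticeTheory.

Section QuasiNormTheory.
Variables (R : realType) (L : quasiBanachLatticeType R).
Implicit Types x y : L.

Lemma qnorm0 : qnorm (0 : L) = 0.
Proof. by rewrite -(scale0r (0 : L)) qnormZ normr0 mul0r. Qed.

Lemma qnorm_vabs x : qnorm (vabs x) = qnorm x.
Proof.
have e : vabs (vabs x) = vabs x by rewrite ge0_vabs ?vabs_ge0.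
by apply/le_anti/andP; split; apply: qnorm_le_vabs; rewrite e.
Qed.

Lemma qnorm_le x y : 0 <= x -> x <= y -> qnorm x <= qnorm y.
Proof.
move=> x0 xy; apply: qnorm_le_vabs.
by rewrite !ge0_vabs // (le_trans x0).
Qed.

(** With [K >= 1] the powers of [K] increase, so one power serves for every term of an iterated
    sum. *)
Lemma quasi_triangle_const : exists2 K : R, 1 <= K &
  forall x y : L, qnorm (x + y) <= K * (qnorm x + qnorm y).
Proof.
have [K hK] := @qnorm_quasi_triangle R L.
exists (Num.max 1 K) => [|x y]; first by rewrite le_max lexx.
apply: (le_trans (hK x y)); apply: ler_wpM2r; first by rewrite addr_ge0 ?qnorm_ge0.
by rewrite le_max lexx orbT.
Qed.

(** The exponential loss is harmless: this is applied with a number [N] of copies that does not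
    depend on the family. *)
Lemma qnorm_sum_le (K : R) (N : nat) (x : 'I_N -> L) : 1 <= K ->
  (forall x y : L, qnorm (x + y) <= K * (qnorm x + qnorm y)) ->
  qnorm (\sum_i x i) <= K ^+ N * \sum_i qnorm (x i).
Proof.
move=> K1 hK; elim: N x => [|N IH] x; first by rewrite !big_ord0 qnorm0 mulr0.
have K0 : 0 <= K by apply: le_trans K1.
rewrite !big_ord_recr /=; apply: (le_trans (hK _ _)).
rewrite exprS -mulrA ler_wpM2l // mulrDr lerD //.
by rewrite ler_peMl ?qnorm_ge0 // exprn_ege1.
Qed.

End QuasiNormTheory.

(** * Continuous positively homogeneous functions *)

Section PositivelyHomogeneous.
Variable R : realType.
Local Open Scope classical_set_scope.

Lemma cvg_ptws (T : Type) (F : set_system T) (J : Type) (X : T -> J -> R)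
    (t : J -> R) : Filter F ->
  (forall j, X x j @[x --> F] --> t j) ->
  X @ F --> (t : {ptws J -> R}).
Proof.
move=> FF h; apply/cvg_sup => j U [V [[W oW <-] Wt WU]].
apply: (filterS WU); apply: (h j); exact: open_nbhs_nbhs.
Qed.

Variable J : finType.
Implicit Types g h : (J -> R) -> R.

Lemma pos_homogeneous0 : pos_homogeneous_fun (fun _ : J -> R => 0).
Proof. by split=> [|a t _]; [exact: cst_continuous | rewrite mulr0]. Qed.

Lemma pos_homogeneous_coord (j : J) : pos_homogeneous_fun (fun t : J -> R => t j).
Proof. by split=> // t; exact: (@proj_continuous J (fun=> R) j t). Qed.

Lemma pos_homogeneous_lin (a : R) g h :
  pos_homogeneous_fun g -> pos_homogeneous_fun h ->
  pos_homogeneous_fun (fun t => a * g t + h t).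
Proof.
move=> [cg hg] [ch hh]; split=> [t|b t b0]; last by rewrite hg // hh //; ring.
by apply: cvgD (ch t); apply: cvgM (cg t); exact: cvg_cst.
Qed.

Lemma pos_homogeneousD g h : pos_homogeneous_fun g -> pos_homogeneous_fun h ->
  pos_homogeneous_fun (fun t => g t + h t).
Proof.
move=> pg ph; have := pos_homogeneous_lin 1 pg ph.
by under eq_fun do rewrite mul1r.
Qed.

Lemma pos_homogeneousZ (a : R) g : pos_homogeneous_fun g ->
  pos_homogeneous_fun (fun t => a * g t).
Proof.
move=> pg; have := pos_homogeneous_lin a pg pos_homogeneous0.
by under eq_fun do rewrite addr0.
Qed.

Lemma pos_homogeneous_max g h : pos_homogeneous_fun g -> pos_homogeneous_fun h ->
  pos_homogeneous_fun (fun t => Num.max (g t) (h t)).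
Proof.
move=> [cg hg] [ch hh]; split=> [t|b t b0]; last by rewrite hg // hh // maxr_pMr.
exact: (continuous_max (cg t) (ch t)).
Qed.

Lemma pos_homogeneous_min g h : pos_homogeneous_fun g -> pos_homogeneous_fun h ->
  pos_homogeneous_fun (fun t => Num.min (g t) (h t)).
Proof.
move=> [cg hg] [ch hh]; split=> [t|b t b0]; last by rewrite hg // hh // minr_pMr.
exact: (continuous_min (cg t) (ch t)).
Qed.

Lemma pos_homogeneous_abs g : pos_homogeneous_fun g ->
  pos_homogeneous_fun (fun t => `|g t|).
Proof.
move=> [cg hg]; split=> [t|b t b0]; last by rewrite hg // normrM ger0_norm.
exact: cvg_norm (cg t).
Qed.

Lemma pos_homogeneous_big (op : R -> R -> R) (I : Type) (s : seq I)
    (g : I -> (J -> R) -> R) :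
  (forall f h, pos_homogeneous_fun f -> pos_homogeneous_fun h ->
    pos_homogeneous_fun (fun t => op (f t) (h t))) ->
  (forall i, pos_homogeneous_fun (g i)) ->
  pos_homogeneous_fun (fun t => \big[op/0]_(i <- s) g i t).
Proof.
move=> hop hg; elim: s => [|i s IH].
  by under eq_fun do rewrite big_nil; exact: pos_homogeneous0.
by under eq_fun do rewrite big_cons; apply: hop.
Qed.

Lemma pos_homogeneous_sum (I : Type) (s : seq I) (g : I -> (J -> R) -> R) :
  (forall i, pos_homogeneous_fun (g i)) ->
  pos_homogeneous_fun (fun t => \sum_(i <- s) g i t).
Proof. by apply: pos_homogeneous_big => *; exact: pos_homogeneousD. Qed.

Lemma pos_homogeneous_comp (E : finType) (X : E -> (J -> R) -> R)
    (h : (E -> R) -> R) :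
  (forall e, pos_homogeneous_fun (X e)) -> pos_homogeneous_fun h ->
  pos_homogeneous_fun (fun t => h (fun e => X e t)).
Proof.
move=> pX [ch hh]; split=> [t|a t a0].
  apply: (@cvg_comp _ _ _ (fun t e => X e t) h (nbhs (t : {ptws J -> R}))
    (nbhs ((fun e => X e t) : {ptws E -> R})) _ _ (ch _)).
  apply: (@cvg_ptws {ptws J -> R} (nbhs t) E (fun t e => X e t) (fun e => X e t)
    (nbhs_filter t)) => e; exact: (pX e).1.
by rewrite -hh //; congr h; apply/funext => e; rewrite (pX e).2.
Qed.

Lemma continuous_abs_powR (p : R) : 0 < p ->
  continuous (fun x : R => `|x| `^ p).
Proof.
move=> p0 x; have [->|x0] := eqVneq x 0.
  rewrite /continuous_at normr0 powR0 ?gt_eqF //.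
  apply/cvgr0Pnorm_lt => e e0; near=> y.
  have -> : e = (e `^ p^-1) `^ p by rewrite -powRrM mulVf ?gt_eqF // powRr1 // ltW.
  rewrite ger0_norm ?powR_ge0 //; apply: gt0_ltr_powR => //; rewrite ?nnegrE ?powR_ge0 //.
  rewrite -[y]subr0 distrC; near: y; apply: cvgr_dist_lt; last exact: powR_gt0.
  exact: cvg_id.
apply: (@cvg_comp _ _ _ (fun x : R => `|x|) (fun x => x `^ p) (nbhs x) (nbhs `|x|)).
  exact: norm_continuous.
suff : {for `|x|, continuous (@powR R ^~ p)} by apply.
apply: differentiable_continuous; apply/derivable1_diffP.
by apply: derivable_powR; rewrite in_itv /= andbT normr_gt0.
Unshelve. all: by end_near. Qed.

Definition lsum_fun (r : R) (t : J -> R) : R :=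
  (\sum_(j : J) `|t j| `^ r) `^ r^-1.

Lemma pos_homogeneous_lsum (r : R) : 0 < r -> pos_homogeneous_fun (lsum_fun r).
Proof.
move=> r0; split=> [t|a t a0].
  pose S (t : {ptws J -> R}) : R := \sum_(j : J) `|t j| `^ r.
  (* The absolute value changes nothing, as the sum is nonnegative; it lets [continuous_abs_powR]
     handle the outer root as well. *)
  have -> : lsum_fun r = fun t => `|S t| `^ r^-1.
    by apply/funext => u; rewrite ger0_norm // sumr_ge0 // => j _; rewrite powR_ge0.
  apply: (@cvg_comp _ _ _ S (fun x : R => `|x| `^ r^-1) (nbhs t) (nbhs (S t))).
    suff : forall s : seq J, continuous
      (fun t : {ptws J -> R} => \sum_(j <- s) `|t j| `^ r : R) by apply.
    elim=> [|j s IH].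
      rewrite (_ : (fun t : {ptws J -> R} => _) = fun=> 0); first exact: cst_continuous.
      by apply/funext => u; rewrite big_nil.
    rewrite (_ : (fun t : {ptws J -> R} => _) =
      fun t => `|t j| `^ r + \sum_(i <- s) `|t i| `^ r); last first.
      by apply/funext => u; rewrite big_cons.
    move=> u; apply: cvgD (IH u).
    apply: (@cvg_comp _ _ _ (fun t : {ptws J -> R} => t j) (fun x : R => `|x| `^ r)
      (nbhs u) (nbhs (u j))).
      exact: (@proj_continuous J (fun=> R) j u).
    exact: continuous_abs_powR.
  by apply: continuous_abs_powR; rewrite invr_gt0.
rewrite /lsum_fun; under eq_bigr do rewrite normrM powRM // (ger0_norm a0).
have S0 : 0 <= \sum_j `|t j| `^ r by apply: sumr_ge0 => j _; exact: powR_ge0.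
rewrite -mulr_sumr powRM ?powR_ge0 //.
by rewrite -powRrM divff ?gt_eqF // powRr1.
Qed.

End PositivelyHomogeneous.

(** * Functional calculus and its uniqueness *)

Section FunctionalCalculus.
Variables (R : realType) (L : vectorLatticeType R) (J : finType) (f : J -> L).
Variable Phi : ((J -> R) -> R) -> L.
Hypothesis PhiP : is_functional_calculus f Phi.
Implicit Types g h : (J -> R) -> R.

Lemma calculus_coord j : Phi (fun t => t j) = f j.
Proof. by case: PhiP. Qed.

Lemma calculus_lin (a : R) g h : pos_homogeneous_fun g -> pos_homogeneous_fun h ->
  Phi (fun t => a * g t + h t) = a *: Phi g + Phi h.
Proof. by case: PhiP => _ + _ _; apply. Qed.

Lemma calculus_max g h : pos_homogeneous_fun g -> pos_homogeneous_fun h ->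
  Phi (fun t => Num.max (g t) (h t)) = vjoin (Phi g) (Phi h).
Proof. by case: PhiP => _ _ + _; apply. Qed.

Lemma calculus_min g h : pos_homogeneous_fun g -> pos_homogeneous_fun h ->
  Phi (fun t => Num.min (g t) (h t)) = vmeet (Phi g) (Phi h).
Proof. by case: PhiP => _ _ _; apply. Qed.

Lemma calculus0 : Phi (fun=> 0) = 0.
Proof.
have := calculus_lin 1 (pos_homogeneous0 R J) (pos_homogeneous0 R J).
under eq_fun do rewrite mulr0 addr0; rewrite scale1r => /eqP.
by rewrite -subr_eq subrr => /eqP <-.
Qed.

Lemma calculusZ (a : R) g : pos_homogeneous_fun g ->
  Phi (fun t => a * g t) = a *: Phi g.
Proof.
move=> pg; have := calculus_lin a pg (pos_homogeneous0 R J).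
by under eq_fun do rewrite addr0; rewrite calculus0 addr0.
Qed.

Lemma calculusD g h : pos_homogeneous_fun g -> pos_homogeneous_fun h ->
  Phi (fun t => g t + h t) = Phi g + Phi h.
Proof.
move=> pg ph; have := calculus_lin 1 pg ph.
by under eq_fun do rewrite mul1r; rewrite scale1r.
Qed.

Lemma calculus_sum (I : Type) (s : seq I) (g : I -> (J -> R) -> R) :
  (forall i, pos_homogeneous_fun (g i)) ->
  Phi (fun t => \sum_(i <- s) g i t) = \sum_(i <- s) Phi (g i).
Proof.
move=> pg; elim: s => [|i s IH].
  by under eq_fun do rewrite big_nil; rewrite big_nil calculus0.
under eq_fun do rewrite big_cons; rewrite big_cons -IH calculusD //.
exact: pos_homogeneous_sum.
Qed.

(** When [g <= h] the maximum of the two is [h], so the join axiom yields the order. This transfers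
    pointwise inequalities to the lattice. *)
Lemma calculus_le g h : pos_homogeneous_fun g -> pos_homogeneous_fun h ->
  (forall t, g t <= h t) -> Phi g <= Phi h.
Proof.
move=> pg ph gh; have := calculus_max pg ph.
rewrite (_ : (fun t => _) = h) => [e|]; last by apply/funext => t; exact: max_r.
by have := lexx (Phi h); rewrite {1}e vjoin_le => /andP[].
Qed.

Lemma calculus_ge0 g : pos_homogeneous_fun g -> (forall t, 0 <= g t) -> 0 <= Phi g.
Proof. by move=> pg g0; rewrite -calculus0; apply: calculus_le => //; exact: pos_homogeneous0. Qed.

Lemma calculus_abs g : pos_homogeneous_fun g -> Phi (fun t => `|g t|) = vabs (Phi g).
Proof.
move=> pg; rewrite /vabs -scaleN1r -calculusZ // -calculus_max //.
  by congr Phi; apply/funext => t; rewrite mulN1r maxrN.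
exact: pos_homogeneousZ.
Qed.

(** The bound [z] must be nonnegative because the iterated maximum starts from 0. *)
Lemma calculus_bigmax_le (I : Type) (s : seq I) (g : I -> (J -> R) -> R) (z : L) :
  (forall i, pos_homogeneous_fun (g i)) -> 0 <= z -> (forall i, Phi (g i) <= z) ->
  Phi (fun t => \big[Num.max/0]_(i <- s) g i t) <= z.
Proof.
move=> pg z0 gz; elim: s => [|i s IH].
  by under eq_fun do rewrite big_nil; rewrite calculus0.
under eq_fun do rewrite big_cons; rewrite calculus_max ?vjoin_le ?gz //.
by apply: pos_homogeneous_big => // *; exact: pos_homogeneous_max.
Qed.

(** Substituting [X] preserves sums, maxima and minima, and sends the coordinate [e] to [X e]. It
    serves for signed sums and for rescaled families. *)
Lemma functional_calculus_comp (E : finType) (X : E -> (J -> R) -> R) :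
  (forall e, pos_homogeneous_fun (X e)) ->
  is_functional_calculus (fun e => Phi (X e))
    (fun u : (E -> R) -> R => Phi (fun t => u (fun e => X e t))).
Proof.
move=> pX; split=> [//|a u v pu pv|u v pu pv|u v pu pv].
- by rewrite calculus_lin //; exact: pos_homogeneous_comp.
- by rewrite calculus_max //; exact: pos_homogeneous_comp.
- by rewrite calculus_min //; exact: pos_homogeneous_comp.
Qed.

End FunctionalCalculus.

(** * Uniform approximation by lattice-linear functions *)

Section Uniqueness.
Variables (R : realType) (J : finType).
Implicit Types (g h : (J -> R) -> R) (t : J -> R).
Local Open Scope classical_set_scope.

(** The vector lattice generated by the coordinates, as an inductive predicate: two calculi of one
    family agree on it by induction. *)
Inductive lattice_linear : ((J -> R) -> R) -> Prop :=
| LatticeLinear0 : lattice_linear (fun=> 0)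
| LatticeLinearCoord j : lattice_linear (fun t => t j)
| LatticeLinearLin a g h : lattice_linear g -> lattice_linear h ->
    lattice_linear (fun t => a * g t + h t)
| LatticeLinearMax g h : lattice_linear g -> lattice_linear h ->
    lattice_linear (fun t => Num.max (g t) (h t))
| LatticeLinearMin g h : lattice_linear g -> lattice_linear h ->
    lattice_linear (fun t => Num.min (g t) (h t)).

Lemma lattice_linear_pos_homogeneous g : lattice_linear g -> pos_homogeneous_fun g.
Proof.
elim=> [|j|a g1 g2 _ ? _ ?|g1 g2 _ ? _ ?|g1 g2 _ ? _ ?].
- exact: pos_homogeneous0.
- exact: pos_homogeneous_coord.
- exact: pos_homogeneous_lin.
- exact: pos_homogeneous_max.
- exact: pos_homogeneous_min.
Qed.

Lemma lattice_linear_calculus (L : vectorLatticeType R) (f : J -> L) Phi Psi g :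
  is_functional_calculus f Phi -> is_functional_calculus f Psi ->
  lattice_linear g -> Phi g = Psi g.
Proof.
move=> hP hQ; elim=> [|j|a g1 g2 l1 e1 l2 e2|g1 g2 l1 e1 l2 e2|g1 g2 l1 e1 l2 e2];
  try have := lattice_linear_pos_homogeneous l1;
  try have := lattice_linear_pos_homogeneous l2.
- by rewrite (calculus0 hP) (calculus0 hQ).
- by rewrite (calculus_coord hP) (calculus_coord hQ).
- by move=> *; rewrite (calculus_lin hP) // (calculus_lin hQ) // e1 e2.
- by move=> *; rewrite (calculus_max hP) // (calculus_max hQ) // e1 e2.
- by move=> *; rewrite (calculus_min hP) // (calculus_min hQ) // e1 e2.
Qed.

Lemma lattice_linearD g h : lattice_linear g -> lattice_linear h ->
  lattice_linear (fun t => g t + h t).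
Proof.
move=> lg lh; have := LatticeLinearLin 1 lg lh.
by under eq_fun do rewrite mul1r.
Qed.

Lemma lattice_linearZ a g : lattice_linear g -> lattice_linear (fun t => a * g t).
Proof.
move=> lg; have := LatticeLinearLin a lg LatticeLinear0.
by under eq_fun do rewrite addr0.
Qed.

Lemma lattice_linear_abs g : lattice_linear g -> lattice_linear (fun t => `|g t|).
Proof.
move=> lg; have := LatticeLinearMax lg (lattice_linearZ (-1) lg).
by under eq_fun do rewrite mulN1r maxrN.
Qed.

Lemma lattice_linear_sum (I : Type) (s : seq I) (g : I -> (J -> R) -> R) :
  (forall i, lattice_linear (g i)) -> lattice_linear (fun t => \sum_(i <- s) g i t).
Proof.
move=> lg; elim: s => [|i s IH].
  by under eq_fun do rewrite big_nil; exact: LatticeLinear0.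
by under eq_fun do rewrite big_cons; exact: lattice_linearD.
Qed.

(** This norm is itself lattice-linear, so it can stand for the constant 1 in homogeneous
    expressions. *)
Definition l1norm t : R := \sum_(j : J) `|t j|.

Lemma lattice_linear_l1norm : lattice_linear l1norm.
Proof.
by apply: lattice_linear_sum => j; apply: lattice_linear_abs; exact: LatticeLinearCoord.
Qed.

Lemma l1norm_ge0 t : 0 <= l1norm t.
Proof. exact: sumr_ge0. Qed.

Lemma le_l1norm t j : `|t j| <= l1norm t.
Proof. by rewrite /l1norm (bigD1 j) //= lerDl sumr_ge0. Qed.

Lemma l1norm_eq0 t : l1norm t = 0 -> t = fun=> 0.
Proof.
move=> t0; apply/funext => j; apply/eqP; rewrite -normr_le0 -t0.
exact: le_l1norm.
Qed.

Definition l1sphere : set {ptws J -> R} := [set t | l1norm t = 1].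

(** The sphere is closed in the cube of side [[-1, 1]], which is compact by Tychonoff's theorem. *)
Lemma compact_l1sphere : compact l1sphere.
Proof.
pose cube : set {ptws J -> R} := [set t | forall j, `[-1, 1] (t j)].
have ccube : compact cube.
  exact: (@tychonoff J (fun=> R) (fun=> `[-1, 1]) (fun=> @segment_compact R _ _)).
apply: subclosed_compact ccube _.
  apply: (@preimage_closed _ _ (l1norm : {ptws J -> R} -> R) [set x | x = 1]).
    move=> t _; exact: (lattice_linear_pos_homogeneous lattice_linear_l1norm).1.
  exact: closed_eq.
move=> t /= t1 j; have := le_l1norm t j; rewrite t1 ler_norml.
by rewrite /= in_itv.
Qed.

(* A continuous [h] is below its value at [y] plus [d], up to a penalty that is
   lattice-linear in [t] on the sphere. *)
Lemma pos_homogeneous_local_bound h (d : R) : pos_homogeneous_fun h -> 0 < d ->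
  forall y, exists M : R, forall t, l1sphere t ->
    h t <= h y + d + M * l1norm (fun j => t j - y j).
Proof.
move=> [ch _] d0 y.
have [B hB] : exists B : R, forall t, l1sphere t -> `|h t| <= B.
  have : compact (h @` l1sphere).
    by apply: continuous_compact compact_l1sphere; exact: continuous_subspaceT.
  move=> /compact_bounded [M [_ hM]]; exists (M + 1) => t tS.
  by apply: hM; [rewrite ltrDl | exists t].
(* The filter of l1-balls around [y] converges to [y] pointwise; this turns continuity of [h] at [y]
   into a radius [e]. *)
pose F : set_system {ptws J -> R} := filter_from [set e : R | 0 < e]
  (fun e => [set t | l1norm (fun j => t j - y j) < e]).
have FF : Filter F.
  apply: filter_from_filter; first by exists 1; exact: ltr01.
  move=> a b /= a0 b0; exists (Num.min a b); first by rewrite /= lt_min a0.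
  by move=> t /=; rewrite lt_min => /andP[].
have Fy : F --> (y : {ptws J -> R}).
  apply: (@cvg_ptws _ _ F J (fun t => t) y FF) => j.
  apply/cvgrPdist_lt => e e0; exists e => // t /= te.
  by rewrite distrC; apply: le_lt_trans te; exact: (le_l1norm (fun j => t j - y j)).
have [e /= e0 he] : F [set t | h t < h y + d].
  apply: Fy; apply: (ch y [set x | x < h y + d]); apply: open_nbhs_nbhs.
  by split; [exact: open_lt | rewrite /= ltrDl].
(* Inside the ball of radius [e] continuity suffices; outside it the penalty is at least
   [B + |h y|], hence at least [h t - h y]. *)
exists ((B + `|h y|) / e) => t tS.
set n := l1norm _.
have B0 : 0 <= B := le_trans (normr_ge0 _) (hB _ tS).
have M0 : 0 <= (B + `|h y|) / e by rewrite divr_ge0 ?addr_ge0 // ltW.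
have [ne|en] := ltP n e.
  apply: (@le_trans _ _ (h y + d)); first by apply/ltW; exact: he.
  by rewrite lerDl mulr_ge0 // l1norm_ge0.
apply: (@le_trans _ _ (h y + d + (B + `|h y|))); last first.
  by rewrite lerD2l mulrAC ler_pdivlMr // ler_wpM2l // addr_ge0.
have := ler_norm (h t); have := hB _ tS; have := ler_norm (- h y); rewrite normrN; lra.
Qed.

(** A Stone-Weierstrass argument from above: each point [y] of the sphere has a lattice-linear
    majorant of [h] that is close to [h] near [y]. Compactness combines them through minima, and
    homogeneity extends the result off the sphere. *)
Lemma lattice_linear_approx h (d : R) : pos_homogeneous_fun h -> 0 < d ->
  exists2 g, lattice_linear g & forall t, h t <= g t <= h t + d * l1norm t.
Proof.
move=> ph d0; have d20 : 0 < d / 2 by rewrite divr_gt0.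
have [M hM] := choice (pos_homogeneous_local_bound ph d20).
(* The bound of [pos_homogeneous_local_bound], with each constant multiplied by [l1norm t] to make
   it lattice-linear; on the sphere nothing changes. *)
pose G (y t : J -> R) := (h y + d / 2) * l1norm t +
  M y * l1norm (fun j => t j + (- y j) * l1norm t).
have lG y : lattice_linear (G y).
  apply: LatticeLinearLin; first exact: lattice_linear_l1norm.
  apply: lattice_linearZ; apply: lattice_linear_sum => j; apply: lattice_linear_abs.
  apply: lattice_linearD; first exact: LatticeLinearCoord.
  by apply: lattice_linearZ; exact: lattice_linear_l1norm.
have GE y t : l1sphere t -> G y t = h y + d / 2 + M y * l1norm (fun j => t j - y j).
  by move=> t1; rewrite /G t1 mulr1; congr (_ + _ * l1norm _); apply/funext => j; rewrite mulr1.
have hG y t : l1sphere t -> h t <= G y t by move=> t1; rewrite GE //; exact: hM.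
(* Majorants are closed under minimum, so the sets [below g0] generate a filter. The near-covering
   form of compactness along it replaces the choice of a finite subcover. *)
pose above : set ((J -> R) -> R) :=
  [set g | lattice_linear g /\ forall t, l1sphere t -> h t <= g t].
pose below g0 : set ((J -> R) -> R) := [set g | above g /\ forall t, g t <= g0 t].
have FF : Filter (filter_from above below).
  apply: filter_from_filter; first by exists (G (fun=> 0)); split=> // t; exact: hG.
  move=> g1 g2 [l1 h1] [l2 h2]; exists (fun t => Num.min (g1 t) (g2 t)).
    by split=> [|t t1]; [exact: LatticeLinearMin | rewrite le_min h1 // h2].
  move=> g [ag gle]; split; split=> // t; apply: (le_trans (gle t)).
    by rewrite ge_min lexx.
  by rewrite ge_min lexx orbT.
have [|g [lg g_ge] gP] := (compact_near_coveringP l1sphere).1 compact_l1sphere _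
    (filter_from above below) (fun g t => -1 * h t + g t < d) FF.
  move=> y y1; exists ([set t | -1 * h t + G y t < d], below (G y)); last first.
    move=> [t g] /= [tU [_ gle]]; apply: le_lt_trans tU.
    by rewrite lerD2l.
  split; last by exists (G y) => //; split=> // t; exact: hG.
  have [cU _] := pos_homogeneous_lin (-1) ph (lattice_linear_pos_homogeneous (lG y)).
  apply: (cU y [set x | x < d]); apply: open_nbhs_nbhs; split; first exact: open_lt.
  rewrite /= GE // (_ : l1norm _ = 0) ?mulr0; first lra.
  by rewrite /l1norm big1 // => j _; rewrite subrr normr0.
have g_lt t : l1sphere t -> -1 * h t + g t < d.
  by apply: gP; split=> //; split.
exists g => // t.
(* At the origin both functions vanish by homogeneity; any other point is rescaled to the sphere. *)
have [t0|t0] := eqVneq (l1norm t) 0.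
  have z k : pos_homogeneous_fun k -> k t = 0.
    move=> [_ hk]; have := hk 0 t (lexx _); rewrite mul0r => <-.
    by congr k; rewrite [in LHS](l1norm_eq0 t0); apply/funext => j; rewrite mul0r.
  by rewrite (z h ph) (z g (lattice_linear_pos_homogeneous lg)) t0 mulr0 addr0 lexx.
have tp : 0 < l1norm t by rewrite lt_neqAle eq_sym t0 l1norm_ge0.
pose u := fun j => (l1norm t)^-1 * t j.
have tE : t = fun j => l1norm t * u j.
  by apply/funext => j; rewrite /u mulVKf.
have u1 : l1sphere u.
  rewrite /l1sphere /= /l1norm; under eq_bigr do rewrite normrM.
  rewrite -mulr_sumr -/(l1norm t) ger0_norm ?invr_ge0 ?l1norm_ge0 //.
  by rewrite mulVf.
have scale k : pos_homogeneous_fun k -> k t = l1norm t * k u.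
  by move=> [_ hk]; rewrite {1}tE hk // ltW.
rewrite (scale h ph) (scale g (lattice_linear_pos_homogeneous lg)).
rewrite [d * _]mulrC -mulrDr !ler_pM2l // g_ge //=.
by have := g_lt _ u1; lra.
Qed.

(** Two calculi agree on a lattice-linear [g] with [h <= g <= h + d * l1norm], so their values at
    [h] differ in absolute value by at most [d *: Phi l1norm]. Letting [d] tend to 0 makes the
    quasi-norm of the difference vanish. *)
Lemma functional_calculus_unique (L : quasiBanachLatticeType R) (f : J -> L) Phi Psi h :
  is_functional_calculus f Phi -> is_functional_calculus f Psi ->
  pos_homogeneous_fun h -> Phi h = Psi h.
Proof.
move=> hP hQ ph; apply/eqP; rewrite -subr_eq0; apply/eqP; apply: qnorm0_eq0.
have ln := lattice_linear_l1norm; have pn := lattice_linear_pos_homogeneous ln.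
apply/le_anti; rewrite qnorm_ge0 andbT.
set N := qnorm (Phi l1norm).
have N0 : 0 <= N by exact: qnorm_ge0.
suff bound (d : R) : 0 < d -> qnorm (Phi h - Psi h) <= d * N.
  apply/ler_addgt0Pr => e e0; rewrite add0r.
  (* The denominator is [N + 1] because [N] may be 0. *)
  apply: (le_trans (bound (e / (N + 1)) _)); first by rewrite divr_gt0 // ltr_wpDl.
  rewrite mulrAC ler_pdivrMr ?ltr_wpDl //; nra.
move=> d0; have [g lg hg] := lattice_linear_approx ph d0.
have pg := lattice_linear_pos_homogeneous lg.
have pgd : pos_homogeneous_fun (fun t => h t + d * l1norm t).
  by apply: pos_homogeneousD => //; exact: pos_homogeneousZ.
have up Th (hT : is_functional_calculus f Th) : Th h <= Phi g /\ Phi g <= Th h + d *: Phi l1norm.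
  rewrite (lattice_linear_calculus hP hT lg) (lattice_linear_calculus hP hT ln); split.
    by apply: (calculus_le hT) => // t; case/andP: (hg t).
  rewrite -(calculusZ hT) // -(calculusD hT) //; last exact: pos_homogeneousZ.
  by apply: (calculus_le hT) => // t; case/andP: (hg t).
have [P1 P2] := up _ hP; have [Q1 Q2] := up _ hQ.
have nn : 0 <= d *: Phi l1norm.
  rewrite -(calculusZ hP) //; apply: (calculus_ge0 hP); first exact: pos_homogeneousZ.
  by move=> t; rewrite mulr_ge0 ?l1norm_ge0 // ltW.
rewrite -(_ : qnorm (d *: Phi l1norm) = d * N); last by rewrite qnormZ gtr0_norm.
apply: qnorm_le_vabs; rewrite (ge0_vabs nn); apply: vabs_le.
  by have := vlat_leD2r (- Psi h) _ _ (le_trans P1 Q2); rewrite addrAC subrr add0r.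
rewrite opprB.
by have := vlat_leD2r (- Phi h) _ _ (le_trans Q1 P2); rewrite addrAC subrr add0r.
Qed.

(** The value picked by [xget] comes from some calculus of [f]; by uniqueness any calculus at hand
    computes it. *)
Lemma krivineE (L : quasiBanachLatticeType R) (f : J -> L) Phi h :
  is_functional_calculus f Phi -> pos_homogeneous_fun h -> krivine f h = Phi h.
Proof.
move=> hP ph; rewrite /krivine.
have [|Psi hQ <-] := @xgetPex _ 0 [set y |
  exists2 Phi0, is_functional_calculus f Phi0 & Phi0 h = y].
  by exists (Phi h); exists Phi.
exact: functional_calculus_unique hQ hP ph.
Qed.

End Uniqueness.

(** * Power means *)

Section PowerMeans.
Variable R : realType.

Definition power_mean (E : finType) (r : R) (q : E -> R) : R :=
  (#|E|%:R^-1 * \sum_(e : E) q e `^ r) `^ r^-1.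

Lemma powR_invK (r x : R) : 0 < r -> 0 <= x -> (x `^ r) `^ r^-1 = x.
Proof. by move=> r0 x0; rewrite -powRrM divff ?gt_eqF // powRr1. Qed.

Lemma powR_invVK (r x : R) : 0 < r -> 0 <= x -> (x `^ r^-1) `^ r = x.
Proof. by move=> r0 x0; rewrite -powRrM mulVf ?gt_eqF // powRr1. Qed.

Lemma sum_powR_ge0 (E : finType) (r : R) (q : E -> R) : 0 <= \sum_(e : E) q e `^ r.
Proof. by apply: sumr_ge0 => e _; exact: powR_ge0. Qed.

Lemma sum_powR_eq0 (E : finType) (r : R) (q : E -> R) :
  \sum_(e : E) q e `^ r = 0 -> forall e, q e = 0.
Proof.
move=> S0 e; apply: (@powR_eq0_eq0 _ _ r); apply/le_anti; rewrite powR_ge0 andbT -S0.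
by rewrite (bigD1 e) //= lerDl sumr_ge0 // => i _; exact: powR_ge0.
Qed.

Lemma power_mean_powR (E : finType) (r : R) (q : E -> R) : 0 < r ->
  power_mean r q `^ r = #|E|%:R^-1 * \sum_(e : E) q e `^ r.
Proof.
by move=> r0; rewrite powR_invVK // mulr_ge0 ?invr_ge0 ?sum_powR_ge0.
Qed.

(** Markov's inequality for [q ^ r]: every counted point contributes more than [eta^-1] times its
    average. *)
Lemma markov_card (E : finType) (q : E -> R) (r eta : R) :
  0 < r -> 0 < eta -> (forall e, 0 <= q e) ->
  #|[pred e | eta^-1 `^ r^-1 * power_mean r q < q e]|%:R <= eta * #|E|%:R.
Proof.
move=> r0 eta0 q0; set B := [pred e | _]; set S := \sum_(e : E) q e `^ r.
have BS e : B e -> eta^-1 * (#|E|%:R^-1 * S) < q e `^ r.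
  rewrite /B /= => h; have := gt0_ltr_powR r0 _ (q0 e) h.
  rewrite powRM ?powR_ge0 // power_mean_powR // powR_invVK // ?invr_ge0 ?(ltW eta0) //.
  by apply; rewrite nnegrE mulr_ge0 ?powR_ge0.
have S0 : 0 <= S by exact: sum_powR_ge0.
have [Sz|Sn] := eqVneq S 0.
  rewrite eq_card0 ?mulr_ge0 // ?(ltW eta0) // => e; apply/negbTE/negP => eB.
  by have := BS e eB; rewrite Sz !mulr0 (sum_powR_eq0 Sz) powR0 ?gt_eqF // ltxx.
have Sp : 0 < S by rewrite lt_neqAle eq_sym Sn.
have [E0|E0] := posnP #|E|.
  have : (#|B| <= #|E|)%N by exact: max_card.
  by rewrite E0 leqn0 => /eqP ->; rewrite mulr0.
have Ep : 0 < #|E|%:R :> R by rewrite ltr0n.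
have : #|B|%:R * (eta^-1 * (#|E|%:R^-1 * S)) <= S.
  rewrite [leRHS](bigID B) /= -[leLHS]addr0; apply: lerD; last first.
    by apply: sumr_ge0 => e _; exact: powR_ge0.
  have -> : #|B|%:R = \sum_(e | B e) 1 :> R by rewrite -sum1_card natr_sum.
  rewrite mulr_suml; apply: ler_sum => e eB.
  by rewrite mul1r; apply/ltW; exact: BS.
rewrite !mulrA -[leRHS]mul1r ler_pM2r // -mulrA -invfM ler_pdivrMr ?mulr_gt0 //.
by rewrite mul1r.
Qed.

(** Monotonicity of power means up to a factor. With [M] the mean of order [p], one has
    [q ^ r <= M ^ r + M ^ r * (q / M) ^ p] pointwise, and each term averages to [M ^ r]. *)
Lemma power_mean_le (E : finType) (q : E -> R) (r p : R) :
  0 < r -> r <= p -> (forall e, 0 <= q e) ->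
  power_mean r q <= 2 `^ r^-1 * power_mean p q.
Proof.
move=> r0 rp q0; have p0 : 0 < p by exact: lt_le_trans rp.
set M := power_mean p q.
have M0 : 0 <= M by exact: powR_ge0.
rewrite -[M](powR_invK r0) // -powRM ?powR_ge0 //.
apply: ge0_ler_powR; rewrite ?invr_ge0 ?(ltW r0) //;
  rewrite ?nnegrE ?mulr_ge0 ?invr_ge0 ?powR_ge0 ?sum_powR_ge0 //.
have [E0|E0] := posnP #|E|.
  by rewrite E0 invr0 mul0r mulr_ge0 ?powR_ge0.
have Ep : 0 < #|E|%:R :> R by rewrite ltr0n.
rewrite ler_pdivrMl //.
have MS : M `^ p = #|E|%:R^-1 * \sum_(e : E) q e `^ p by exact: power_mean_powR.
have [Mz|Mn] := eqVneq M 0.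
  rewrite Mz powR0 ?gt_eqF // in MS.
  move/esym/eqP: MS; rewrite mulf_eq0 invr_eq0 (gt_eqF Ep) /= => /eqP/sum_powR_eq0 qz.
  by rewrite big1 ?mulr_ge0 ?powR_ge0 // => e _; rewrite qz powR0 ?gt_eqF.
have Mp : 0 < M by rewrite lt_neqAle eq_sym Mn.
apply: (@le_trans _ _ (\sum_(e : E) (M `^ r + M `^ r * (q e `^ p / M `^ p)))).
  apply: ler_sum => e _; have [qM|Mq] := leP (q e) M.
    apply: (@le_trans _ _ (M `^ r)); first by apply: ge0_ler_powR; rewrite ?nnegrE ?(ltW r0).
    by rewrite lerDl mulr_ge0 ?divr_ge0 ?powR_ge0.
  rewrite -[X in _ + X]addr0 -[leLHS]add0r lerD ?powR_ge0 // addr0.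
  have x1 : 1 <= q e / M by rewrite ler_pdivlMr // mul1r ltW.
  have -> : q e = M * (q e / M) by rewrite mulrC divfK.
  have x0 : 0 <= q e / M by rewrite divr_ge0.
  rewrite !(powRM _ M0 x0) ler_wpM2l ?powR_ge0 // mulrAC divff ?mul1r; last first.
    by rewrite gt_eqF // powR_gt0.
  exact: ler_powR.
rewrite big_split /= -mulr_sumr -mulr_suml.
have -> : \sum_(e : E) q e `^ p = #|E|%:R * M `^ p.
  by rewrite MS mulVKf // gt_eqF.
have -> : \sum_(e : E) M `^ r = #|E|%:R * M `^ r by rewrite sumr_const mulr_natl.
have -> : #|E|%:R * M `^ p / M `^ p = #|E|%:R.
  by rewrite mulfK // gt_eqF // powR_gt0.
lra.
Qed.

Lemma powR_interp_le (th x y : R) : 0 <= th <= 1 -> 0 <= x -> 0 <= y ->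
  x `^ (1 - th) * y `^ th <= x + y.
Proof.
move=> /andP[t0 t1] x0 y0.
wlog xy : th x y t0 t1 x0 y0 / x <= y => [hw|].
  have [xy|yx] := leP x y; first exact: hw.
  have := hw (1 - th) y x; rewrite subKr mulrC [y + x]addrC.
  by apply; rewrite ?(ltW yx) //; lra.
apply: (@le_trans _ _ y); last by rewrite lerDr.
apply: (@le_trans _ _ (y `^ (1 - th) * y `^ th)).
  by rewrite ler_wpM2r ?powR_ge0 //; apply: ge0_ler_powR; rewrite ?nnegrE //; lra.
by rewrite -powRD ?subrK ?powRr1 // oner_eq0.
Qed.

(** Hoelder's inequality up to the factor 2: after division by their sums, [u] and [v] each total 1,
    and [powR_interp_le] applies termwise. *)
Lemma sum_powR_interp_le (J : finType) (u v : J -> R) (th : R) : 0 < th <= 1 ->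
  (forall j, 0 <= u j) -> (forall j, 0 <= v j) -> 0 < \sum_j u j ->
  \sum_j u j `^ (1 - th) * v j `^ th <=
  2 * ((\sum_j u j) `^ (1 - th) * (\sum_j v j) `^ th).
Proof.
move=> /andP[t0 t1] u0 v0; set U := \sum_j u j; set V := \sum_j v j => U0.
have V0 : 0 <= V by exact: sumr_ge0.
have [Vz|Vn] := eqVneq V 0.
  rewrite Vz [0 `^ th]powR0 ?gt_eqF // !mulr0 big1 // => j _.
  have -> : v j = 0.
    by apply/le_anti; rewrite v0 andbT -Vz /V (bigD1 j) //= lerDl sumr_ge0.
  by rewrite powR0 ?gt_eqF // mulr0.
have Vp : 0 < V by rewrite lt_neqAle eq_sym Vn.
apply: (@le_trans _ _ (\sum_j U `^ (1 - th) * V `^ th * (u j / U + v j / V))).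
  apply: ler_sum => j _.
  have uU : 0 <= u j / U by rewrite divr_ge0 // ltW.
  have vV : 0 <= v j / V by rewrite divr_ge0.
  have {1}-> : u j = U * (u j / U) by rewrite mulrC divfK // gt_eqF.
  have {1}-> : v j = V * (v j / V) by rewrite mulrC divfK // gt_eqF.
  rewrite (powRM _ (ltW U0) uU) (powRM _ V0 vV) mulrACA ler_wpM2l ?mulr_ge0 ?powR_ge0 //.
  by apply: powR_interp_le => //; rewrite ltW.
rewrite -mulr_sumr big_split /= -!mulr_suml -/U -/V !divff ?gt_eqF //.
by rewrite mulrC.
Qed.

Lemma lsum_fun2E (J : finType) (t : J -> R) :
  lsum_fun 2 t = Num.sqrt (\sum_(j : J) t j ^+ 2).
Proof.
rewrite /lsum_fun powR12_sqrt ?sum_powR_ge0 //; congr Num.sqrt.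
by apply: eq_bigr => j _; rewrite powR_mulrn // real_normK // num_real.
Qed.

Lemma lsum_fun_ge0 (J : finType) (r : R) (t : J -> R) : 0 <= lsum_fun r t.
Proof. exact: powR_ge0. Qed.

(** The l^q norm interpolates between the maximum and the sum. This form uses only multiples, maxima
    and sums of the [|t j|], so a calculus can evaluate the bound in the lattice. *)
Lemma lsum_fun_le_max (J : finType) (q lam : R) (t : J -> R) : 1 <= q -> 0 < lam ->
  lsum_fun q t <= Num.max (lam * \big[Num.max/0]_(j : J) `|t j|)
                          (lam `^ (1 - q) * \sum_(j : J) `|t j|).
Proof.
move=> q1 lam0; have q0 : 0 < q by exact: lt_le_trans q1.
set m := \big[_/_]_j _; set S := \sum_j `|t j|.
have m0 : 0 <= m by exact: bigmax_ge_id.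
have S0 : 0 <= S by exact: sumr_ge0.
have tS : \sum_(j : J) `|t j| `^ q <= m `^ (q - 1) * S.
  rewrite /S mulr_sumr; apply: ler_sum => j _.
  rewrite -(mulr_powRB1 (normr_ge0 (t j)) q0) mulrC ler_wpM2r //.
  apply: ge0_ler_powR; rewrite ?nnegrE ?subr_ge0 //.
  exact: (le_bigmax _ (fun j => `|t j|)).
have root (z : R) : 0 <= z -> \sum_(j : J) `|t j| `^ q <= z `^ q -> lsum_fun q t <= z.
  move=> z0 h; rewrite -(powR_invK q0 z0); apply: ge0_ler_powR => //.
    by rewrite invr_ge0 ltW.
  by rewrite nnegrE sum_powR_ge0.
by rewrite nnegrE powR_ge0.
rewrite le_max; have [Sm|mS] := leP S (lam `^ q * m); apply/orP; [left|right].
  apply: root; first by rewrite mulr_ge0 // ltW.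
  apply: (le_trans tS); rewrite powRM // ?(ltW lam0) //.
  rewrite -(mulr_powRB1 m0 q0) mulrA [leRHS]mulrC; exact: ler_wpM2l (powR_ge0 _ _) _ _ Sm.
apply: root; first by rewrite mulr_ge0 ?powR_ge0.
have l0 : 0 < lam `^ (- q) by exact: powR_gt0.
have mS' : m <= lam `^ (- q) * S.
  by rewrite powRN mulrC ler_pdivlMr ?powR_gt0 // mulrC ltW.
apply: (le_trans tS); rewrite powRM ?powR_ge0 // -(mulr_powRB1 S0 q0) [S * _]mulrC mulrA.
apply: ler_wpM2r => //.
have -> : (lam `^ (1 - q)) `^ q = (lam `^ (- q)) `^ (q - 1).
  by rewrite -!powRrM; congr (_ `^ _); ring.
rewrite -powRM ?powR_ge0 //; apply: ge0_ler_powR; rewrite ?nnegrE ?subr_ge0 //.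
by rewrite mulr_ge0 ?powR_ge0.
Qed.

End PowerMeans.

(** * L-convex lattices *)

Section SignedSums.
Variables (R : realType) (J : finType).

Lemma pos_homogeneous_signed_sum (e : {ffun J -> bool}) :
  pos_homogeneous_fun (@signed_sum R J e).
Proof.
apply: pos_homogeneous_sum => j; apply: pos_homogeneousZ.
exact: pos_homogeneous_coord.
Qed.

Lemma calculus_signed_sum (L : vectorLatticeType R) (f : J -> L) Phi
    (e : {ffun J -> bool}) : is_functional_calculus f Phi ->
  Phi (signed_sum e) = \sum_(j : J) (-1) ^+ e j *: f j.
Proof.
move=> hP; rewrite (calculus_sum hP) => [|j]; last first.
  by apply: pos_homogeneousZ; exact: pos_homogeneous_coord.
apply: eq_bigr => j _; rewrite (calculusZ hP) ?(calculus_coord hP) //.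
exact: pos_homogeneous_coord.
Qed.

Lemma A_avgE (L : quasiBanachLatticeType R) (r : R) (f : J -> L) :
  A_avg r f = power_mean r (fun e : {ffun J -> bool} =>
    qnorm (\sum_(j : J) (-1) ^+ e j *: f j)).
Proof. by rewrite /power_mean card_signs. Qed.

Lemma lsumE (L : quasiBanachLatticeType R) (f : J -> L) Phi (r : R) : 0 < r ->
  is_functional_calculus f Phi -> lsum r f = Phi (lsum_fun r).
Proof. by move=> r0 hP; exact: (krivineE hP (pos_homogeneous_lsum J r0)). Qed.

(** This default makes the lower estimate trivial for a family without a calculus, and is what
    L-concavity exploits to rule out such families. *)
Lemma krivine_none (L : vectorLatticeType R) (f : J -> L) h :
  (forall Phi, ~ is_functional_calculus f Phi) -> krivine f h = 0.
Proof. by move=> nP; apply: xgetPN => y [Phi hP _]; exact: nP hP. Qed.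

End SignedSums.

Lemma bernoulli_le (R : realType) (x : R) (n : nat) : 0 <= x <= 1 ->
  1 - n%:R * x <= (1 - x) ^+ n.
Proof.
move=> /andP[x0 x1]; elim: n => [|n IH]; first by rewrite mul0r subr0 expr0.
apply: (@le_trans _ _ ((1 - x) * (1 - n%:R * x))); last first.
  by rewrite exprS ler_wpM2l // subr_ge0.
have : 0 <= n%:R * x ^+ 2 by rewrite mulr_ge0 ?sqr_ge0.
by rewrite -natr1; lra.
Qed.

Section LowerEstimate.
Variables (R : realType) (L : quasiBanachLatticeType R).

(* Among the [N]-tuples of sign vectors, a proportion of at most [(1 - d) ^+ N]
   has all its sums small at a given point (Paley-Zygmund), and at least
   [1 - N * eta] has all its norms at most [tau * A_avg r f] (Markov). *)
Lemma L_convex_lower : L_convex L -> forall r : R, 0 < r ->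
  exists C : R, forall (J : finType) (f : J -> L), L2_norm f <= C * A_avg r f.
Proof.
move=> [eps [eps0 eps1 convex]] r r0.
have [d /andP[d0 d1] small_card] := card_small_signed_sum R.
have [K K1 quasi] := quasi_triangle_const L.
have K0 : 0 <= K by exact: le_trans K1.
(* Half of the allowed proportion [eps] goes to tuples whose sums are all small, the other half to
   tuples containing a large norm. *)
have [N hN] : exists N : nat, (1 - d) ^+ N <= eps / 2.
  have d' : `|1 - d| < 1 by rewrite ger0_norm; lra.
  have /cvgr0Pnorm_lt/(_ (eps / 2)) := cvg_expr d'.
  case=> [|N _ hN]; first by rewrite divr_gt0.
  by exists N; apply/ltW/(le_lt_trans (ler_norm _))/(hN N) => /=.
have N0 : (0 < N)%N by case: N hN => // ; rewrite expr0; lra.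
have Np : 0 < N%:R :> R by rewrite ltr0n.
(* By Bernoulli's inequality [(1 - eta) ^+ N >= 1 - eps / 2]. *)
pose eta := eps / 2 / N%:R.
have eta0 : 0 < eta by rewrite !divr_gt0.
have N1 : 1 <= N%:R :> R by rewrite ler1n.
have eta1 : eta <= 1 by rewrite ler_pdivrMr //; lra.
pose tau := eta^-1 `^ r^-1.
have tau0 : 0 <= tau by exact: powR_ge0.
(* The 2 is the factor in the truncation [w], [K ^+ N] comes from adding [N] vectors of norm at most
   [tau * A_avg r f], and [1 / eps] from L-convexity. *)
pose C := 2 * K ^+ N * (N%:R * tau) / eps.
have C0 : 0 <= C by rewrite divr_ge0 ?(ltW eps0) // !mulr_ge0 ?exprn_ge0.
exists C => J f; have A0 : 0 <= A_avg r f by exact: powR_ge0.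
have [[Phi hP]|nP] := pselect (exists Phi, is_functional_calculus f Phi); last first.
  rewrite /L2_norm /lsum krivine_none => [|Phi hP].
    by rewrite qnorm0 (mulr_ge0 C0 A0).
  by apply: nP; exists Phi.
have p2 : pos_homogeneous_fun (@lsum_fun R J 2) by exact: pos_homogeneous_lsum.
have -> : L2_norm f = qnorm (Phi (lsum_fun 2)) by rewrite /L2_norm (lsumE _ hP).
set h2 : (J -> R) -> R := lsum_fun 2 in p2 *.
have h20 t : 0 <= h2 t by exact: lsum_fun_ge0.
pose E := {ffun J -> bool}; pose T := {ffun 'I_N -> E}.
pose P : R := 2 ^+ #|J|.
have P0 : 0 < P by exact: exprn_gt0.
have cardT : #|T|%:R = P ^+ N :> R by rewrite card_ffun card_ord natrX card_signs.
pose g (e : E) := Phi (signed_sum e).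
pose good : pred E := [pred e | qnorm (g e) <= tau * A_avg r f].
pose small (t : J -> R) : pred E := [pred e | 4 * signed_sum e t ^+ 2 < \sum_j t j ^+ 2].
have card_good : (1 - eta) * P <= #|good|%:R.
  have := markov_card r0 eta0 (fun e : E => qnorm_ge0 (\sum_j (-1) ^+ e j *: f j)).
  rewrite -A_avgE card_signs -/P -/tau.
  rewrite (_ : #|_| = #|[predC good]|); last first.
    by apply: eq_card => e; rewrite !inE -ltNge /g (calculus_signed_sum _ hP).
  by have := card_signs R J; rewrite -(cardC good) natrD -/P; lra.
pose allgood (s : T) := s \in ffun_on good.
pose allsmall t (s : T) := s \in ffun_on (small t).
(* Truncation at [h2] gives the upper bound required by L-convexity; the factor 2 makes
   [w s t = h2 t] as soon as one sum of the tuple is not small. *)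
pose w (s : T) (t : J -> R) := Num.min (2 * \sum_(i < N) `|signed_sum (s i) t|) (h2 t).
have pX (e : E) : pos_homogeneous_fun (fun t : J -> R => `|signed_sum e t|).
  by apply: pos_homogeneous_abs; exact: pos_homogeneous_signed_sum.
have psum (s : T) : pos_homogeneous_fun (fun t : J -> R => \sum_(i < N) `|signed_sum (s i) t|).
  by apply: pos_homogeneous_sum => i; exact: pX.
have p2sum (s : T) := pos_homogeneousZ 2 (psum s).
have pw s : pos_homogeneous_fun (w s) by exact: pos_homogeneous_min.
have w0 s t : 0 <= w s t.
  by rewrite le_min h20 andbT mulr_ge0 // sumr_ge0.
(* Discarded tuples are kept with value 0, so the index set is all of [T] and proportions can be
   counted. *)
pose F (s : T) := Phi (fun t => (allgood s)%:R * w s t).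
have pF (s : T) : pos_homogeneous_fun (fun t => (allgood s)%:R * w s t).
  exact: pos_homogeneousZ.
have FE s : F s = (allgood s)%:R *: Phi (w s) by exact: (calculusZ hP).
(* At a fixed [t], the sum is at least [h2 t] times the number of all-good tuples minus the number
   of all-small ones. *)
have lower t : (1 - eps) * #|T|%:R * h2 t <= \sum_(s : T) (allgood s)%:R * w s t.
  apply: (@le_trans _ _ (\sum_(s : T) ((allgood s)%:R - (allsmall t s)%:R) * h2 t)); last first.
    apply: ler_sum => s _; case ag: (allgood s); case ls: (allsmall t s);
      rewrite ?subrr ?subr0 ?sub0r ?mul0r ?mul1r ?mulNr ?mul1r //.
      have /forallPn [i] : ~~ [forall i, small t (s i)].
        by apply/negP => /forallP h; move/negP: ls; apply; apply/ffun_onP => i; exact: h.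
      rewrite /small /= -leNgt => h4; rewrite le_min lexx andbT.
      apply: (@le_trans _ _ (2 * `|signed_sum (s i) t|)).
        rewrite /h2 lsum_fun2E -[leRHS]ger0_norm ?mulr_ge0 // -sqrtr_sqr ler_sqrt ?sqr_ge0 //.
        by rewrite exprMn real_normK ?num_real // -natrX.
      by rewrite ler_pM2l // (bigD1 i) //= lerDl sumr_ge0.
    by rewrite oppr_le0.
  rewrite -mulr_suml; apply: ler_wpM2r => //; rewrite sumrB.
  have count (Q : pred E) : \sum_(s : T) (s \in ffun_on Q)%:R = #|Q|%:R ^+ N :> R.
    by rewrite -natr_sum -big_mkcond /= sum1_card card_ffun_on card_ord natrX.
  rewrite (count good) (count (small t)) cardT.
  have g1 : (1 - eps / 2) * P ^+ N <= #|good|%:R ^+ N.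
    apply: (@le_trans _ _ (((1 - eta) * P) ^+ N)).
      rewrite exprMn ler_wpM2r ?exprn_ge0 ?(ltW P0) //.
      apply: le_trans (bernoulli_le N _); last by rewrite (ltW eta0).
      by rewrite /eta [_ * (_ / _)]mulrC divfK // gt_eqF.
    by apply: lerXn2r card_good; rewrite nnegrE ?mulr_ge0 ?subr_ge0 ?(ltW P0).
  have g2 : #|small t|%:R ^+ N <= eps / 2 * P ^+ N.
    apply: (@le_trans _ _ (((1 - d) * P) ^+ N)).
      by apply: lerXn2r (small_card J t); rewrite nnegrE ?mulr_ge0 ?subr_ge0 ?(ltW P0).
    by rewrite exprMn ler_wpM2r // exprn_ge0 // ltW.
  by lra.
have cardT0 : (0 < #|T|)%N by rewrite -(ltr0n R) cardT exprn_gt0.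
have F0 (s : T) : 0 <= F s /\ F s <= Phi h2.
  split; first by apply: (calculus_ge0 hP) => // t; rewrite mulr_ge0.
  apply: (calculus_le hP) => // t; apply: (@le_trans _ _ (w s t)).
    by rewrite ler_piMl // lern1 leq_b1.
  by rewrite ge_min lexx orbT.
have Flow : ((1 - eps) * #|T|%:R) *: Phi h2 <= \sum_(s : T) F s.
  rewrite -(calculusZ hP) // -(calculus_sum hP) //.
  apply: (calculus_le hP) => //; first exact: pos_homogeneousZ.
  exact: pos_homogeneous_sum.
have := convex T F (Phi h2) cardT0 F0 Flow.
rewrite mulrC -ler_pdivlMr // => /le_trans; apply.
rewrite /C mulrAC ler_pM2r ?invr_gt0 //.
apply: bigmax_le => [|s _]; first by rewrite !mulr_ge0 ?exprn_ge0.
rewrite FE; case ag: (allgood s); last first.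
  by rewrite scale0r qnorm0 !mulr_ge0 ?exprn_ge0.
rewrite scale1r; apply: (@le_trans _ _ (qnorm (2 *: \sum_(i < N) vabs (g (s i))))).
  apply: qnorm_le; first exact: (calculus_ge0 hP).
  rewrite (_ : 2 *: _ = Phi (fun t => 2 * \sum_(i < N) `|signed_sum (s i) t|)).
    by apply: (calculus_le hP) => // t; rewrite ge_min lexx.
  rewrite (calculusZ hP) // (calculus_sum hP) => [|i]; last exact: pX.
  congr (_ *: _); apply: eq_bigr => i _; rewrite (calculus_abs hP) //.
  exact: pos_homogeneous_signed_sum.
rewrite qnormZ ger0_norm // -!mulrA ler_pM2l //.
apply: (le_trans (qnorm_sum_le _ K1 quasi)); rewrite ler_wpM2l ?exprn_ge0 //.
rewrite mulr_natl -[N in _ *+ N]card_ord -sumr_const; apply: ler_sum => i _.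
by rewrite qnorm_vabs; move/ffun_onP/(_ i): ag.
Qed.

End LowerEstimate.

(** * L-concave lattices *)

Section Concave.
Variables (R : realType) (L : quasiBanachLatticeType R).

(* Where Krivine's calculus is missing, [lsum] is [0], and L-concavity forces
   the family to vanish; the zero family has the zero calculus. *)
Lemma L_concave_calculus : L_concave L -> forall (J : finType) (f : J -> L),
  exists Phi, is_functional_calculus f Phi.
Proof.
move=> [s [C [s0 concave]]] J f; apply: contrapT => nP.
have nP' Phi : ~ is_functional_calculus f Phi by move=> hP; apply: nP; exists Phi.
have := concave J f; rewrite /lsum krivine_none // qnorm0 mulr0 => S0.
have f0 j : f j = 0.
  apply: qnorm0_eq0; apply: (@sum_powR_eq0 _ _ s (fun j => qnorm (f j))).
  apply: (@powR_eq0_eq0 _ _ s^-1); apply/le_anti; rewrite powR_ge0 andbT.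
  exact: S0.
have join0 : vjoin (0 : L) 0 = 0.
  apply/le_anti; rewrite vjoin_le lexx /=.
  by have := lexx (vjoin (0 : L) 0); rewrite {1}vjoin_le => /andP[].
have meet0 : vmeet (0 : L) 0 = 0.
  apply/le_anti; rewrite le_vmeet lexx /= andbT.
  by have := lexx (vmeet (0 : L) 0); rewrite {1}le_vmeet => /andP[].
apply: (nP' (fun=> 0)); split=> [j|a g h _ _|g h _ _|g h _ _] //.
by rewrite scaler0 addr0.
Qed.

(* Apply s-concavity to the family [a_j f_j] with [a_j = |f_j| ^ (q / s - 1)],
   for which Hoelder's inequality is sharp. *)
Lemma L_concave_raise : L_concave L -> exists s C : R, [/\ 0 < s, 0 <= C &
  forall q : R, s <= q -> forall (J : finType) (f : J -> L) Phi,
    is_functional_calculus f Phi ->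
    (\sum_(j : J) qnorm (f j) `^ q) `^ q^-1 <= C * qnorm (Phi (lsum_fun q))].
Proof.
move=> [s [C0 [s0 concave]]].
(* The constant in the definition of L-concavity carries no sign. *)
pose C := Num.max 0 C0.
have C_ge0 : 0 <= C by rewrite le_max lexx.
exists s, (C * 2 `^ s^-1); split=> // [|q sq J f Phi hP].
  by rewrite mulr_ge0 ?powR_ge0.
have q0 : 0 < q by exact: lt_le_trans sq.
pose n j := qnorm (f j).
have n0 j : 0 <= n j by exact: qnorm_ge0.
set S := \sum_(j : J) _.
have S0 : 0 <= S by exact: sum_powR_ge0.
have [Sz|Sn] := eqVneq S 0.
  rewrite Sz powR0 ?invr_eq0 ?gt_eqF // !mulr_ge0 ?powR_ge0 //; exact: qnorm_ge0.
have Sp : 0 < S by rewrite lt_neqAle eq_sym Sn.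
(* The exponent is chosen so that [(a j * n j) ^ s = n j ^ q], making the left side of s-concavity
   [S ^ (1 / s)]. *)
pose a j := n j `^ (q / s - 1).
have a0 j : 0 <= a j by exact: powR_ge0.
pose th := s / q.
have th01 : 0 < th <= 1 by rewrite divr_gt0 //= ler_pdivrMr // mul1r.
pose X j (t : J -> R) := a j * t j.
have pX j : pos_homogeneous_fun (X j).
  by apply: pos_homogeneousZ; exact: pos_homogeneous_coord.
have hQ := functional_calculus_comp hP pX.
have pq := pos_homogeneous_lsum J q0; have ps := pos_homogeneous_lsum J s0.
have XE j : Phi (X j) = a j *: f j.
  by rewrite (calculusZ hP) ?(calculus_coord hP) //; exact: pos_homogeneous_coord.
have := concave J (fun j => Phi (X j)).
rewrite (lsumE s0 hQ).
have -> : \sum_(j : J) qnorm (Phi (X j)) `^ s = S.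
  apply: eq_bigr => j _; rewrite XE qnormZ ger0_norm // -/(n j).
  by rewrite /a mulrC mulr_powRB1 ?divr_gt0 // -powRrM divfK // gt_eqF.
(* The s-th root of the constant in [sum_powR_interp_le], with [(1 - th) / s = 1 / s - 1 / q]. The
   power of [S] is cancelled at the end, leaving [S ^ (1 / q)]. *)
pose c := 2 `^ s^-1 * S `^ (s^-1 - q^-1).
have c0 : 0 <= c by rewrite mulr_ge0 ?powR_ge0.
have point t : lsum_fun s (fun j => X j t) <= c * lsum_fun q t.
  rewrite /lsum_fun; set V := \sum_j `|t j| `^ q.
  have V0 : 0 <= V by exact: sum_powR_ge0.
  have -> : c * V `^ q^-1 = (2 * (S `^ (1 - th) * V `^ th)) `^ s^-1.
    have SV0 := mulr_ge0 (powR_ge0 S (1 - th)) (powR_ge0 V th).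
    rewrite [RHS](powRM _ (ler0n R 2) SV0).
    rewrite [X in _ = _ * X](powRM s^-1 (powR_ge0 S (1 - th)) (powR_ge0 V th)).
    rewrite /c -mulrA; congr (_ * (_ * _)); apply: etrans (powRrM _ _ _);
      by congr (_ `^ _); rewrite /th; field; rewrite !gt_eqF.
  apply: ge0_ler_powR; rewrite ?nnegrE ?invr_ge0 ?(ltW s0) ?sum_powR_ge0 ?mulr_ge0 ?powR_ge0 //.
  have -> : \sum_j `|X j t| `^ s = \sum_j (n j `^ q) `^ (1 - th) * (`|t j| `^ q) `^ th.
    apply: eq_bigr => j _; rewrite /X normrM (ger0_norm (a0 j)) powRM // /a -!powRrM.
    by congr (_ `^ _ * _ `^ _); rewrite /th; field; rewrite ?gt_eqF.
  by apply: sum_powR_interp_le => // j; exact: powR_ge0.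
move=> h; have {h} main : S `^ s^-1 <= C * (c * qnorm (Phi (lsum_fun q))).
  apply: (le_trans h).
  apply: (@le_trans _ _ (C * qnorm (Phi (fun t => lsum_fun s (fun j => X j t))))).
    by apply: ler_wpM2r; [exact: qnorm_ge0 | rewrite le_max lexx orbT].
  have pc : pos_homogeneous_fun (fun t => lsum_fun s (fun j => X j t)).
    exact: pos_homogeneous_comp pX ps.
  apply: (ler_wpM2l C_ge0).
  have -> : c * qnorm (Phi (lsum_fun q)) = qnorm (Phi (fun t => c * lsum_fun q t)).
    by rewrite (calculusZ hP c pq) qnormZ (ger0_norm c0).
  apply: qnorm_le; first by apply: (calculus_ge0 hP) => // t; exact: lsum_fun_ge0.
  exact: (calculus_le hP pc (pos_homogeneousZ c pq) point).
have Sc0 : 0 < S `^ (s^-1 - q^-1) by exact: powR_gt0.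
rewrite -(ler_pM2r Sc0) -powRD; last by rewrite Sn implybT.
rewrite addrC subrK; apply: (le_trans main); rewrite /c.
by rewrite le_eqVlt; apply/orP; left; apply/eqP; ring.
Qed.

(* For [G_j = f - F_j], q-concavity bounds the norms of the [G_j] from below
   by those of the [F_j], while [(\sum_j G_j ^ q) ^ (1 / q) <= (eps n) ^ (1 / q) f]. *)
Lemma L_concave_convex : L_concave L -> L_convex L.
Proof.
move=> concave; have [s [C [s0 C0 raise]]] := L_concave_raise concave.
have [K K1 quasi] := quasi_triangle_const L.
(* The interpolation [lsum_fun_le_max] requires [q >= 1]. *)
pose q := Num.max 1 s.
have q1 : 1 <= q by rewrite le_max lexx.
have sq : s <= q by rewrite le_max lexx orbT.
have q0 : 0 < q by exact: lt_le_trans q1.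
(* With [eps = B ^ (- q)], the two estimates of the l^q sum of the norms of the [G j] will force
   [B <= 2 * K * C], which this choice excludes. *)
pose B := 2 * K * (C + 1).
have B2 : 2 * K <= B by rewrite ler_peMr; lra.
have B0 : 0 < B by lra.
pose eps := B^-1 `^ q.
have BV : 0 < B^-1 <= 1 by rewrite invr_gt0 B0 invf_le1 //; lra.
have epsB : eps <= B^-1 by exact: ge1r_powR.
have B12 : B^-1 <= (2 * K)^-1 by rewrite lef_pV2 ?posrE //; lra.
have K12 : (2 * K)^-1 <= 2^-1 by rewrite lef_pV2 ?posrE //; lra.
have eps0 : 0 < eps by rewrite powR_gt0 // invr_gt0.
exists eps; split=> [//| |J F f cardJ hF sumF]; first by lra.
rewrite leNgt; apply/negP => small.
have F_lt j : qnorm (F j) < eps * qnorm f.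
  by apply: le_lt_trans small; exact: (le_bigmax _ (fun j => qnorm (F j))).
have nf0 : 0 < qnorm f.
  have : 0 < eps * qnorm f.
    by case/card_gt0P: cardJ => j _; exact: le_lt_trans (qnorm_ge0 (F j)) (F_lt j).
  by rewrite pmulr_rgt0.
have f0 : 0 <= f.
  by case/card_gt0P: cardJ => j _; case: (hF j) => h1 h2; exact: le_trans h1 h2.
pose G j := f - F j.
have G0 j : 0 <= G j by rewrite vlat_subr_ge0; case: (hF j).
have Gf j : G j <= f.
  by rewrite -vlat_subr_ge0 /G opprB addrC subrK; case: (hF j).
(* As [f = F j + G j] and the norm of [F j] is below [qnorm f / (2 * K)], the quasi-triangle
   inequality leaves at least this much to [G j]. *)
have Gnorm j : qnorm f / (2 * K) <= qnorm (G j).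
  have := quasi (F j) (G j); rewrite /G [F j + _]addrC subrK -/(G j) => h.
  have h2 : qnorm f / K <= qnorm (F j) + qnorm (G j).
    by rewrite ler_pdivrMr 1?mulrC //; lra.
  have h3 : eps * qnorm f <= (2 * K)^-1 * qnorm f by rewrite ler_wpM2r ?(ltW nf0) //; lra.
  have e2 : qnorm f / K = qnorm f / (2 * K) + qnorm f / (2 * K).
    by field; apply/lt0r_neq0; lra.
  rewrite [_^-1 * _]mulrC in h3.
  have := F_lt j; lra.
have n0 : 0 < #|J|%:R :> R by rewrite ltr0n.
have en0 : 0 < eps * #|J|%:R by rewrite mulr_gt0.
have sumG : \sum_j G j <= (eps * #|J|%:R) *: f.
  rewrite /G sumrB sumr_const -scaler_nat.
  have := vlat_leD (lexx ((#|J|%:R : R) *: f)) (vlat_leN sumF).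
  rewrite -scaleNr -scalerDl => /le_trans; apply.
  by rewrite (_ : _ + _ = eps * #|J|%:R) //; ring.
have [Phi hP] := L_concave_calculus concave G.
(* This value balances the interpolation: [G j <= f] bounds the maximum term by [lam *: f], and
   [sumG] bounds the sum term by [lam ^ (1 - q) * lam ^ q = lam] times [f]. *)
pose lam := (eps * #|J|%:R) `^ q^-1.
have lam0 : 0 < lam by exact: powR_gt0.
have lamq : lam `^ q = eps * #|J|%:R by rewrite powR_invVK // ltW.
have pabs j : pos_homogeneous_fun (fun t : J -> R => `|t j|).
  by apply: pos_homogeneous_abs; exact: pos_homogeneous_coord.
have absE j : Phi (fun t => `|t j|) = G j.
  rewrite (calculus_abs hP) ?(calculus_coord hP) ?ge0_vabs //.
  exact: pos_homogeneous_coord.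
have pmax : pos_homogeneous_fun (fun t : J -> R => \big[Num.max/0]_j `|t j|).
  by apply: pos_homogeneous_big => // *; exact: pos_homogeneous_max.
have psum : pos_homogeneous_fun (fun t : J -> R => \sum_j `|t j|).
  exact: pos_homogeneous_sum.
have PhiG : Phi (lsum_fun q) <= lam *: f.
  apply: (@le_trans _ _ (Phi (fun t => Num.max (lam * \big[Num.max/0]_j `|t j|)
      (lam `^ (1 - q) * \sum_j `|t j|)))).
    apply: (calculus_le hP); first exact: pos_homogeneous_lsum.
      by apply: pos_homogeneous_max; exact: pos_homogeneousZ.
    by move=> t; exact: lsum_fun_le_max.
  rewrite (calculus_max hP); [|exact: pos_homogeneousZ|exact: pos_homogeneousZ].
  rewrite vjoin_le !(calculusZ hP) //; apply/andP; split.
    apply: vlat_leZ2l; first exact: ltW.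
    by apply: (calculus_bigmax_le hP) => // j; rewrite absE.
  rewrite (calculus_sum hP) //; under eq_bigr do rewrite absE.
  have := vlat_leZ2l (lam `^ (1 - q)) _ _ (powR_ge0 _ _) sumG.
  by rewrite scalerA -lamq -powRD ?subrK ?powRr1 ?oner_eq0 // ltW.
have pq := pos_homogeneous_lsum J q0.
have up : (\sum_(j : J) qnorm (G j) `^ q) `^ q^-1 <= C * (lam * qnorm f).
  apply: (le_trans (raise q sq J G Phi hP)); rewrite ler_wpM2l //.
  rewrite -[lam in leRHS]gtr0_norm // -qnormZ; apply: qnorm_le PhiG.
  by apply: (calculus_ge0 hP) => // t; exact: lsum_fun_ge0.
have fK0 : 0 <= qnorm f / (2 * K) by rewrite divr_ge0 ?(ltW nf0) //; lra.
have low : #|J|%:R `^ q^-1 * (qnorm f / (2 * K)) <= (\sum_(j : J) qnorm (G j) `^ q) `^ q^-1.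
  rewrite -{1}(powR_invK q0 fK0) -powRM ?powR_ge0 //.
  apply: ge0_ler_powR; rewrite ?nnegrE ?invr_ge0 ?(ltW q0) ?sum_powR_ge0 ?mulr_ge0 ?powR_ge0 //.
  rewrite mulr_natl -sumr_const; apply: ler_sum => j _.
  by apply: ge0_ler_powR; rewrite ?nnegrE ?(ltW q0) ?qnorm_ge0.
have := le_trans low up.
rewrite /lam powRM ?(ltW eps0) // [eps `^ _](powR_invK q0) ?invr_ge0 ?(ltW B0) //.
have nq0 : 0 < #|J|%:R `^ q^-1 :> R by exact: powR_gt0.
rewrite (_ : C * _ = #|J|%:R `^ q^-1 * (C / B * qnorm f)); last by ring.
rewrite ler_pM2l // [qnorm f / _]mulrC ler_pM2r // -[_^-1]mul1r ler_pdivrMr; last by lra.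
rewrite mulrAC ler_pdivlMr // mul1r /B.
by rewrite leNgt => /negP; apply; nra.
Qed.

(** Scalar Khintchine with roots taken: both sides are now positively homogeneous of degree 1, so a
    calculus can carry the inequality into the lattice. *)
Lemma lsum_fun_signed_sum_le (J : finType) (m : nat) (t : J -> R) : (0 < m)%N ->
  lsum_fun (2 * m)%:R (fun e : {ffun J -> bool} => signed_sum e t) <=
  (khintchine_const R m * 2 ^+ #|J|) `^ (2 * m)%:R^-1 * lsum_fun 2 t.
Proof.
move=> m0; have q0 : 0 < (2 * m)%:R :> R by rewrite ltr0n muln_gt0.
have c0 : 0 <= khintchine_const R m * 2 ^+ #|J|.
  by rewrite /khintchine_const !mulr_ge0 ?exprn_ge0 ?expR_ge0.
rewrite -[lsum_fun 2 t](powR_invK q0) ?lsum_fun_ge0 // -powRM ?powR_ge0 //.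
apply: ge0_ler_powR; rewrite ?nnegrE ?invr_ge0 ?(ltW q0) ?sum_powR_ge0 ?mulr_ge0 ?powR_ge0 //.
rewrite powR_mulrn ?lsum_fun_ge0 // lsum_fun2E [_ ^+ (2 * m)]exprM sqr_sqrtr; last first.
  by apply: sumr_ge0 => j _; exact: sqr_ge0.
apply: le_trans (sum_signed_sum_even_power_le t m0).
by apply: ler_sum => e _; rewrite powR_mulrn // !exprM real_normK // num_real.
Qed.

Lemma L_concave_upper : L_concave L -> forall r : R, 0 < r ->
  exists C : R, forall (J : finType) (f : J -> L), A_avg r f <= C * L2_norm f.
Proof.
move=> concave r r0; have [s [C [s0 C0 raise]]] := L_concave_raise concave.
(* The exponent must be even for Khintchine, at least [s] for concavity, and at least [r] for
   comparing power means. *)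
have [m [m0 sq rq]] : exists m : nat, [/\ (0 < m)%N, s <= (2 * m)%:R & r <= (2 * m)%:R].
  exists (Num.bound (s + r)).+1; have sr0 : 0 <= s + r by lra.
  have := archi_boundP sr0; rewrite natrM -natr1.
  by move=> h; split=> //; lra.
pose q : R := (2 * m)%:R.
have q0 : 0 < q by exact: lt_le_trans s0 sq.
pose k := khintchine_const R m.
have k0 : 0 <= k by rewrite /k /khintchine_const !mulr_ge0 ?exprn_ge0 ?expR_ge0.
(* The factors come from [power_mean_le], from q-concavity and from Khintchine. The number of sign
   vectors cancels against the normalization of the mean. *)
exists (2 `^ r^-1 * (C * k `^ q^-1)) => J f.
have [Phi hP] := L_concave_calculus concave f.
rewrite /L2_norm (lsumE _ hP) // A_avgE.
have pX (e : {ffun J -> bool}) := pos_homogeneous_signed_sum R e.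
have hQ := functional_calculus_comp hP pX.
have := raise q sq _ _ _ hQ.
under eq_bigr do rewrite (calculus_signed_sum _ hP).
set g := fun e : {ffun J -> bool} => _ => h.
apply: (le_trans (power_mean_le r0 rq (fun e => qnorm_ge0 _))).
rewrite -mulrA ler_wpM2l ?powR_ge0 // /power_mean card_signs.
set P : R := 2 ^+ #|J|; have P0 : 0 < P by exact: exprn_gt0.
rewrite powRM ?invr_ge0 ?(ltW P0) ?sum_powR_ge0 //.
apply: (@le_trans _ _ (P^-1 `^ q^-1 * (C * ((k * P) `^ q^-1 * qnorm (Phi (lsum_fun 2)))))).
  rewrite ler_wpM2l ?powR_ge0 //; apply: (le_trans h); rewrite ler_wpM2l //.
  rewrite -[X in X * _]ger0_norm ?powR_ge0 // -qnormZ.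
  have p2 : pos_homogeneous_fun (@lsum_fun R J 2) by exact: pos_homogeneous_lsum.
  have pc := pos_homogeneous_comp pX (pos_homogeneous_lsum _ q0).
  rewrite -(calculusZ hP) //; apply: qnorm_le.
    by apply: (calculus_ge0 hP) => // t; exact: lsum_fun_ge0.
  apply: (calculus_le hP) => // [|t]; first exact: pos_homogeneousZ.
  exact: lsum_fun_signed_sum_le.
have PV : P^-1 `^ q^-1 * P `^ q^-1 = 1.
  by rewrite -powRM ?invr_ge0 ?(ltW P0) // mulVf ?gt_eqF // powR1.
rewrite powRM ?(ltW P0) // le_eqVlt; apply/orP; left; apply/eqP.
transitivity (P^-1 `^ q^-1 * P `^ q^-1 * (C * k `^ q^-1 * qnorm (Phi (lsum_fun 2)))); first by ring.
by rewrite PV mul1r.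
Qed.

End Concave.

Theorem lemma2p5 (R : realType) (L : quasiBanachLatticeType R) :
  (L_convex L ->
     forall r : R, 0 < r ->
       exists C : R, forall (J : finType) (f : J -> L),
         L2_norm f <= C * A_avg r f)
  /\
  (L_concave L ->
     forall r : R, 0 < r ->
       exists C : R, forall (J : finType) (f : J -> L),
         L2_norm f <= C * A_avg r f /\ A_avg r f <= C * L2_norm f).
Proof.
split=> [|concave r r0]; first exact: L_convex_lower.
have [C1 h1] := L_convex_lower (L_concave_convex concave) r0.
have [C2 h2] := L_concave_upper concave r0.
exists (Num.max C1 C2) => J f; split.
  apply: (le_trans (h1 J f)); apply: ler_wpM2r; first exact: powR_ge0.
  by rewrite le_max lexx.
apply: (le_trans (h2 J f)); apply: ler_wpM2r; first exact: qnorm_ge0.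
by rewrite le_max lexx orbT.
Qed.
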